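(* Let $\alpha>0$, $0<\beta<\tfrac1{10}$, $0<\gamma<\tfrac1{301}$, $s,r>0$, and $I^0\in\mathbb C^{\mathbb Z}$ with $0<\|I^0\|<1$. Let $H(I,\theta)=H_0(I)+\epsilon H_1(I,\theta)$ on $\widetilde{\mathcal D}_{s,r}$ satisfy the conditions $(\mathcal A_0)$, $(\mathcal A_1)$, $(\mathcal A_2)$, $(\mathcal B_0)$, $(\mathcal B_1)$ written out in the context, with $\epsilon>0$ sufficiently small (depending on $s,r,I^0,\gamma$) and $\omega(I^0)\in\mathcal R^\infty$, and let $\Psi_*:\widetilde{\mathcal D}_{\frac12s,\frac12r}\to\widetilde{\mathcal D}_{s,r}$ be the real-analytic symplectic transformation described in the context, so that $$H_*=H\circ\Psi_*=e_*+\langle\omega(I^0),I-I^0\rangle+\tfrac12\langle\Omega_*(I-I^0),I-I^0\rangle+P_*(I-I^0,\theta),$$ where $P_*$ contains only terms of order at least $3$ in $I-I^0$. Then $\mathcal T(I^0)=(\mathbb R/2\pi\mathbb Z)^{\mathbb Z}\times\{I=I^0\}$ is a full dimensional KAM torus with frequency $\omega(I^0)$ for the Hamiltonian $H_*$, and $\mathcal T:=\Psi_*(\mathcal T(I^0))$ is a full dimensional KAM torus for the initial Hamiltonian $H$.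
   Context: KAM torus. A full dimensional KAM torus with frequency $\omega$ is an invariant torus parametrized by all the angles $\theta=(\theta_j)_{j\in\mathbb Z}$ on which the Hamiltonian flow (equations $\dot\theta=\partial H/\partial I$, $\dot I=-\partial H/\partial\theta$, for the standard symplectic structure $d\theta\wedge dI$) is conjugate to the linear flow $\dot\theta=\omega$. Norms and domains. $\alpha>0$ is fixed. On $I=(I_j)_{j\in\mathbb Z}\in\mathbb C^{\mathbb Z}$ put $\|I\|=\sum_{j\in\mathbb Z}|I_j|e^{|j|^{1+\alpha}}$ and $|I|_\infty=\sup_j|I_j|$. $\mathbb T^{\mathbb Z}=(\mathbb C/2\pi\mathbb Z)^{\mathbb Z}$. For $s,r>0$, $\widetilde{\mathcal D}_{s,r}=\{(I,\theta)\in\mathbb C^{\mathbb Z}\times\mathbb T^{\mathbb Z}:\|I-I^0\|<s,\ |\mathrm{Im}\,\theta|_\infty<r\}$. Set $|(I,\theta)|_{\mathcal P}=\max(\|I\|,|\theta|_\infty)$; $|\Phi|_D$ is the supremum of $|\Phi|_{\mathcal P}$ over $D$. For an operator $B$ on $\mathbb C^{\mathbb Z}$, $|||B|||=\sup_{\|I\|\ne0}\|BI\|/\|I\|$. $a\lessdot b$ means $a\le Cb$ with $C\ge1$ depending only on $\alpha,\gamma$. Scales. For $k\ge0$: $\epsilon_k=\epsilon^{(1+\beta)^k}$; $8\sigma_k=\frac{(k+1)^{-2}}{2\sum_{j\ge1}j^{-2}}\,r$; $\mathbb L^0=1$, $\mathbb L^{k+1}=\big(\tfrac{1+\beta}{5}|\ln\epsilon_k|\big)^{1/(1+\alpha)}$;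 $M^{k+1}=2\sigma_k^{-1}|\ln\epsilon_k|$. Hamiltonian. $H_0(I)=\sum_{j\in\mathbb Z}\sum_{|i-j|\le1}h_{(i,j)}(I_i,I_j)$ and $H_1(I,\theta)=\sum_{j\in\mathbb Z}\sum_{|i-j|\le1}f_{(i,j)}(I_i,I_j,\theta_i,\theta_j)$. Conditions. $(\mathcal A_0)$ Each $h_{(i,j)}$ is analytic on $\widetilde{\mathcal D}_{s,r}$ and real for real arguments. $(\mathcal A_1)$ Let $\omega=\omega(I^0)=\frac{\partial H_0}{\partial I}(I^0)$ and $\omega(k)=(\omega_j)_{|j|\le\mathbb L^k-1}$. For every $k\ge1$ and every integer vector $v$ indexed by $|j|\le\mathbb L^k-1$ with $0<|v|<M^k$ ($|v|=\sum_j|v_j|$), $|\langle\omega(k),v\rangle|\ge(\epsilon^{(1+\beta)^{k-1}})^{\gamma}$. $(\mathcal A_2)$ Let $\Omega=\frac{\partial^2H_0}{\partial I^2}(I^0)$ and $\Omega(k)=(\Omega_{ij})_{|i|,|j|\le\mathbb L^k-1}$. There are $0<\kappa_1,\kappa_2<\infty$ such that for every $k\ge1$, $\Omega(k)$ is invertible and $|||\bar\Omega(k)|||\le\kappa_1$, $|||\bar\Omega^{-1}(k)|||\le\kappa_2$, where the bar denotes extension of the finite matrices $\Omega(k)$, $\Omega(k)^{-1}$ by zero to operators on $\mathbb C^{\mathbb Z}$. $(\mathcal B_0)$ Each $f_{(i,j)}$ is analytic on $\widetilde{\mathcal D}_{s,r}$ and real for real arguments. $(\mathcal B_1)$ $f_{(i,j)}=\sum_{\alpha_i+\alpha_j\ge5}\widetilde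 a_{\alpha_i\alpha_j}(\theta_i,\theta_j)I_i^{\alpha_i}I_j^{\alpha_j}$, i.e. $f_{(i,j)}$ contains only terms of order at least $5$ in the actions. Non-resonant set. For $k\ge1$, $\mathcal N^k=\bigcup_{0<|v|\le M^k}\{\omega\in\mathbb R^{\mathbb Z}:|\omega(k)\cdot v|\le\epsilon_{k-1}^{\gamma}\}$ ($v$ integer vectors indexed by $|j|\le\mathbb L^k-1$), and $\mathcal R^\infty=\mathbb R^{\mathbb Z}\setminus\bigcup_{k\ge1}\mathcal N^k$. The transformation $\Psi_*$. The main theorem of the paper states that, for $0<\epsilon\le\epsilon_0(s,r,I^0,\gamma)$ and $\omega(I^0)\in\mathcal R^\infty$, there is a real-analytic symplectic transformation $\Psi_*:\widetilde{\mathcal D}_{\frac12s,\frac12r}\to\widetilde{\mathcal D}_{s,r}$ bringing $H$ to the form displayed in the claim, with a constant $e_*$ and an operator $\Omega_*$ on $\mathbb C^{\mathbb Z}$ satisfying $|\Psi_*-\mathrm{id}|_{\widetilde{\mathcal D}_{\frac12s,\frac12r}}\lessdot\epsilon^{17/50}$, $|e_*-H_0(I^0)|\lessdot2\epsilon$, $|||\Omega_*-\Omega|||\lessdot\epsilon^{1/5}$. This $\Psi_*$ is the one in the claim. *)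

(* Defs.v *)
From HB Require Import structures.
From mathcomp Require Import all_boot all_order all_algebra.
From mathcomp Require Import complex.
From mathcomp Require Import all_classical all_reals all_analysis.

Set Implicit Arguments.
Unset Strict Implicit.
Unset Printing Implicit Defensive.

Import Order.TTheory GRing.Theory Num.Theory numFieldNormedType.Exports.
Local Open Scope classical_set_scope.
Local Open Scope complex_scope.
Local Open Scope ring_scope.

(* [R[i]^o] is [R[i]] with its topology of a normed space over itself; the
   plain [R[i]] would be scaled by the reals.                               *)
Notation Cx R := (R[i]^o).
Notation Seq R := (int -> Cx R).

(* Angles live on the universal cover: a point of the torus (C / 2 pi Z)^Z is
   represented by any of its lifts, a function on the torus by a function of
   the lifts that is invariant under [tshift], a map of the torus homotopic to
   the identity by an equivariant map, a subset of the torus by its saturated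
   preimage.                                                                *)
Notation Phase R := (Seq R * Seq R)%type.

Section Sequences.
Variable R : realType.
Implicit Types (F x y : Seq R) (z : Phase R) (k : int -> int).

Definition cabs (c : R[i]) : R := complex.Re `|c|.

Definition is_real_seq x : Prop := forall j, complex.Im (x j) = 0.
Definition is_real z : Prop := is_real_seq z.1 /\ is_real_seq z.2.

Definition unit_seq (j : int) : Seq R := fun i => (i == j)%:R.

Definition of_angle (theta : int -> R) : Seq R := fun j => (theta j)%:C.

Definition period k : int -> R := fun j => 2 * pi * (k j)%:~R.
Definition tshift k z : Phase R := (z.1, z.2 + of_angle (period k)).

(* Sums over Z are limits of symmetric partial sums; this is the sum of the
   family whenever it is absolutely convergent.                             *)
Definition zpartial F (N : nat) : Cx R :=
  \sum_(k < (2 * N).+1) F (k%:Z - N%:Z).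
Definition zcvg F : Prop := cvgn (zpartial F).
Definition zsum F : Cx R := limn (zpartial F).

Definition pairing x y : Cx R := zsum (fun j => x j * y j).

Definition partial (F : Seq R -> Cx R) (j : int) x : Cx R :=
  derive1 (fun t : Cx R => F (x + t *: unit_seq j)) 0.

(* Row-finite matrices only: the sum is 0 by convention if its support is
   infinite.                                                                *)
Definition mxop (A : int -> int -> Cx R) x : Seq R :=
  fun i => \sum_(j \in [set: int]) A i j * x j.

End Sequences.

Section Norms.
Variables (R : realType) (alpha : R).
Implicit Types (x : Seq R) (z u v : Phase R) (D : set (Phase R)).
Local Open Scope ereal_scope.

Definition weight (j : int) : R := expR ((`|j|%N%:R : R) `^ (1 + alpha)).

Definition norm1 x : \bar R :=
  \esum_(j in [set: int]) (cabs (x j) * weight j)%:E.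
Definition norm_sup x : \bar R := ereal_sup (range (fun j => (cabs (x j))%:E)).
Definition im_sup x : \bar R :=
  ereal_sup (range (fun j => (`|complex.Im (x j)|)%:E)).
Definition normP z : \bar R := maxe (norm1 z.1) (norm_sup z.2).

Definition dom (c : Seq R) (s r : R) : set (Phase R) :=
  [set z | norm1 (z.1 - c)%R < s%:E /\ im_sup z.2 < r%:E].

Definition norm_on D (Phi : Phase R -> Phase R) : \bar R :=
  ereal_sup [set normP (Phi z) | z in D].

Definition opnorm (B : Seq R -> Seq R) : \bar R :=
  ereal_sup [set norm1 (B x) / norm1 x | x in [set x | 0 < norm1 x < +oo]].

(* Analyticity is meant in the sense of complex Banach spaces: continuous
   differentiability over C, for [normP] on the source and [N] on the target.
   The tangent space is {u | normP u < +oo}; the values of the derivative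
   elsewhere are irrelevant.                                                *)
Section Analytic.
Variables (V : lmodType R[i]) (N : V -> \bar R).

Definition is_fderiv (F : Phase R -> V) z (A : {linear Phase R -> V}) : Prop :=
  (exists M : R, forall u, normP u < +oo -> N (A u) <= M%:E * normP u) /\
  (forall e : R, (0 < e)%R -> exists2 d : R, (0 < d)%R &
     forall u, normP u < d%:E ->
       N (F (z + u) - F z - A u)%R <= e%:E * normP u).

Definition analytic_gen D (F : Phase R -> V) : Prop :=
  exists dF : Phase R -> {linear Phase R -> V},
    (forall z, D z -> is_fderiv F z (dF z)) /\
    (forall z, D z -> forall e : R, (0 < e)%R -> exists2 d : R, (0 < d)%R &
       forall z', D z' -> normP (z' - z)%R < d%:E ->
         forall u, normP u < +oo ->
           N (dF z' u - dF z u)%R <= e%:E * normP u).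

End Analytic.

Definition analytic D (F : Phase R -> Cx R) : Prop :=
  analytic_gen (fun c : Cx R => (cabs c)%:E) D F.
Definition analytic_map D (Psi : Phase R -> Phase R) : Prop :=
  analytic_gen normP D Psi.

Definition real_on D (F : Phase R -> Cx R) : Prop :=
  forall z, D z -> is_real z -> complex.Im (F z) = 0%R.
Definition real_map_on D (Psi : Phase R -> Phase R) : Prop :=
  forall z, D z -> is_real z -> is_real (Psi z).

Definition periodic_on D (F : Phase R -> Cx R) : Prop :=
  forall k z, D z -> F (tshift k z) = F z.
Definition equivariant_on D (Psi : Phase R -> Phase R) : Prop :=
  forall k z, D z -> Psi (tshift k z) = tshift k (Psi z).

(* dtheta /\ dI *)
Definition sympl_form u v : Cx R :=
  zsum (fun j => u.2 j * v.1 j - v.2 j * u.1 j)%R.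

Definition symplectic_on D (Psi : Phase R -> Phase R) : Prop :=
  forall z (A : {linear Phase R -> Phase R}), D z -> is_fderiv normP Psi z A ->
    forall u v, normP u < +oo -> normP v < +oo ->
      sympl_form (A u) (A v) = sympl_form u v.

End Norms.

Section KamTorus.
Variables (R : realType) (alpha : R).

Definition has_deriv (f : R -> Cx R) (l : Cx R) (t : R) : Prop :=
  is_derive t (1 : R) (fun x => complex.Re (f x)) (complex.Re l) /\
  is_derive t (1 : R) (fun x => complex.Im (f x)) (complex.Im l).

(* Real time, complex phase space; the equations hold coordinate by coordinate
   because the frequencies may be unbounded, in which case a linear flow is not
   even continuous in time for the sup norm of the angles.                  *)
Definition ham_solution (H : Phase R -> Cx R) (z : R -> Phase R) : Prop :=
  forall (t : R) (j : int),
    has_deriv (fun x => (z x).2 j)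
              (partial (fun I => H (I, (z t).2)) j (z t).1) t /\
    has_deriv (fun x => (z x).1 j)
              (- partial (fun theta => H ((z t).1, theta)) j (z t).2) t.

(* [K] is an embedding of the real torus with image [T], and it carries the
   linear flow to solutions of the equations of motion, which therefore stay
   on [T]. By equivariance, the continuity of [K] and of its inverse between
   lifts is continuity between points modulo 2 pi.                          *)
Definition kam_torus (D : set (Phase R)) (H : Phase R -> Cx R)
    (omega : int -> R) (T : set (Phase R)) : Prop :=
  exists K : (int -> R) -> Phase R,
    [/\ T = range K /\ T `<=` D,
        injective K,
        forall k theta, K (theta + period R k) = tshift k (K theta),
        forall theta (e : R), 0 < e ->
          (exists2 d : R, 0 < d & forall theta',
             (norm_sup (of_angle (theta' - theta)%R) < d%:E)%E ->
             (normP alpha (K theta' - K theta)%R < e%:E)%E) /\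
          (exists2 d : R, 0 < d & forall theta',
             (normP alpha (K theta' - K theta)%R < d%:E)%E ->
             (norm_sup (of_angle (theta' - theta)%R) < e%:E)%E)
      & forall theta,
          ham_solution H (fun t => K (fun j => theta j + t * omega j))].

Definition flat_torus (I0 : Seq R) : set (Phase R) :=
  [set z | z.1 = I0 /\ exists theta : int -> R, z.2 = of_angle theta].

End KamTorus.

Section Scales.
Variables (R : realType) (alpha beta gamma r eps : R).

Definition eps_ (k : nat) : R := eps `^ ((1 + beta) ^+ k).

Definition inv_squares : R := limn (series (fun j : nat => (j.+1%:R : R) ^- 2)).
Definition sigma (k : nat) : R := (k.+1%:R ^- 2 / (2 * inv_squares) * r) / 8.

Definition scaleL (k : nat) : R :=
  if k is k'.+1 then
    ((1 + beta) / 5 * `|ln (eps_ k')|) `^ (1 + alpha)^-1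
  else 1.

(* Only used for positive k. *)
Definition scaleM (k : nat) : R :=
  if k is k'.+1 then 2 * (sigma k')^-1 * `|ln (eps_ k')| else 0.

Definition box (k : nat) : set int :=
  [set j | (`|j|%N%:R : R) <= scaleL k - 1].

Definition box_vector (k : nat) (v : int -> int) : Prop :=
  forall j, ~ box k j -> v j = 0.
Definition vnorm (k : nat) (v : int -> int) : R :=
  \sum_(j \in box k) (`|v j|%:~R : R).
Definition box_dot (k : nat) (w : int -> R) (v : int -> int) : R :=
  \sum_(j \in box k) w j * (v j)%:~R.

Definition resonant (k : nat) : set (int -> R) :=
  [set w | exists v : int -> int,
     [/\ box_vector k v, 0 < vnorm k v, vnorm k v <= scaleM k
       & `|box_dot k w v| <= eps_ k.-1 `^ gamma]].

Definition nonresonant : set (int -> R) :=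
  ~` \bigcup_(k in [set k : nat | (1 <= k)%N]) resonant k.

End Scales.

Section Hamiltonian.
Variable R : realType.
Implicit Types (h : int -> int -> Cx R -> Cx R -> Cx R)
  (f : int -> int -> Cx R -> Cx R -> Cx R -> Cx R -> Cx R).

Definition neighbours (j : int) : seq int := [:: j - 1; j; j + 1].

Definition h_at h (i j : int) (z : Phase R) : Cx R := h i j (z.1 i) (z.1 j).
Definition f_at f (i j : int) (z : Phase R) : Cx R :=
  f i j (z.1 i) (z.1 j) (z.2 i) (z.2 j).

Definition site0 h (I : Seq R) (j : int) : Cx R :=
  \sum_(i <- neighbours j) h i j (I i) (I j).
Definition site1 f (z : Phase R) (j : int) : Cx R :=
  \sum_(i <- neighbours j) f_at f i j z.

Definition H0 h (I : Seq R) : Cx R := zsum (site0 h I).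
Definition H1 f (z : Phase R) : Cx R := zsum (site1 f z).
Definition Ham (eps : R) h f (z : Phase R) : Cx R := H0 h z.1 + eps%:C * H1 f z.

Definition hessian h (I0 : Seq R) (i j : int) : Cx R :=
  partial (partial (H0 h) j) i I0.

(* What writing H = H0 + eps H1 on D presupposes: both series converge there,
   to analytic functions.                                                   *)
Definition ham_defined (alpha : R) (D : set (Phase R)) h f : Prop :=
  (forall z, D z -> zcvg (site0 h z.1) /\ zcvg (site1 f z)) /\
  analytic alpha D (fun z => H0 h z.1) /\ analytic alpha D (H1 f).

Definition condA0 (alpha : R) (D : set (Phase R)) h : Prop :=
  forall i j, i \in neighbours j ->
    analytic alpha D (h_at h i j) /\ real_on D (h_at h i j).

Definition condA1 (alpha beta gamma r eps : R) (omega : int -> R) : Prop :=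
  forall (k : nat) (v : int -> int), (1 <= k)%N ->
    box_vector alpha beta eps k v ->
    0 < vnorm alpha beta eps k v < scaleM beta r eps k ->
    eps_ beta eps k.-1 `^ gamma <= `|box_dot alpha beta eps k omega v|.

Definition restrict_mx (B : set int) (A : int -> int -> Cx R) i j : Cx R :=
  if (i \in B) && (j \in B) then A i j else 0.

(* [A'] is the inverse of the restriction of [A] to the indices in the finite
   set [B], extended by zero.                                               *)
Definition inverse_on (B : set int) (A A' : int -> int -> Cx R) : Prop :=
  (forall i j, ~ (B i /\ B j) -> A' i j = 0) /\
  (forall i j, B i -> B j ->
     \sum_(l \in B) A i l * A' l j = (i == j)%:R /\
     \sum_(l \in B) A' i l * A l j = (i == j)%:R).

Definition condA2 (alpha beta eps : R) (Omega : int -> int -> Cx R) : Prop :=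
  exists kappa1 kappa2 : R, [/\ 0 < kappa1, 0 < kappa2 &
    forall k : nat, (1 <= k)%N ->
      let B := box alpha beta eps k in
      exists Theta : int -> int -> Cx R,
        [/\ inverse_on B Omega Theta,
            (opnorm alpha (mxop (restrict_mx B Omega)) <= kappa1%:E)%E
          & (opnorm alpha (mxop Theta) <= kappa2%:E)%E]].

Definition condB0 (alpha : R) (D : set (Phase R)) f : Prop :=
  forall i j, i \in neighbours j ->
    [/\ analytic alpha D (f_at f i j), real_on D (f_at f i j)
      & periodic_on D (f_at f i j)].

Definition condB1 (D : set (Phase R)) f : Prop :=
  forall i j, i \in neighbours j ->
    exists a : nat -> nat -> Cx R -> Cx R -> Cx R,
      (forall m n x y, (m + n < 5)%N -> a m n x y = 0) /\
      (forall z, D z ->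
        (fun N : nat => \sum_(m < N) \sum_(n < N)
           a m n (z.2 i) (z.2 j) * (z.1 i) ^+ m * (z.1 j) ^+ n : Cx R)
          @ \oo --> f_at f i j z).

(* The Taylor expansion of [P] in the actions at I = 0 starts at order [n]: its
   term of degree m at I is the m-th derivative of t |-> P (t I, theta) at 0,
   divided by m!.                                                           *)
Definition order_ge (n : nat) (D : set (Phase R)) (P : Phase R -> Cx R) : Prop :=
  forall z, D z -> forall m, (m < n)%N ->
    derive1n m (fun t : Cx R => P (t *: z.1, z.2)) 0 = 0.

End Hamiltonian.

(* Main.v *)
(** Write a point of the flat torus as [z = (I0, theta)] and [A = dPsi z]. A
    Cauchy estimate turns the bound on [Psi - id] into [|A - 1| <= 1/2], so that
    [Psi] is bi-Lipschitz on the torus and [A] is invertible. By symplecticity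
    the derivative of a coordinate of [Psi], i.e. of [sympl_form (Psi _) w] with
    [w] a basis vector, is [u |-> sympl_form u b] where [A b = w]; hence its
    derivative in the angles is a summable family, with the weights of [norm1].
    This has two consequences. First, the coordinates of [Psi] on the real
    torus are uniformly continuous for the product topology. Second,
    differentiating the normal form of [H o Psi] along [b] gives
    [dH w = sum_i omega_i b_i], which is the Hamiltonian vector field, and
    formally the derivative of the coordinate along [(0, omega)].

    The frequencies may be unbounded, so the linear flow is not differentiable
    in the sup norm, and the last identity is not a chain rule. It is recovered
    from the truncated frequencies: [H] couples only neighbouring sites, so
    [dH w] is continuous in the product topology, and at each point the
    truncated sums converge to it; a Zorn argument glues steps made with
    truncations that depend on the point. *)

Require Import Defs.
From HB Require Import structures.
From mathcomp Require Import all_boot all_order all_algebra.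
From mathcomp Require Import complex.
From mathcomp Require Import all_classical all_reals all_analysis.
From mathcomp Require Import ring lra zify.

Set Implicit Arguments.
Unset Strict Implicit.
Unset Printing Implicit Defensive.

Import Order.TTheory GRing.Theory Num.Theory numFieldNormedType.Exports.
Local Open Scope classical_set_scope.
Local Open Scope complex_scope.
Local Open Scope ring_scope.

(** * The modulus of complex numbers *)

Section ComplexModulus.
Variable R : realType.
Implicit Types (c d : R[i]).

(** The constant [eps0] is chosen so that [Cst] times eps^(17/50) is at most rho/4, where rho =
    min(s/2, r/2). Cauchy's estimate for [Psi - id] then gives 2 (rho/4) / rho = 1/2, the
    contraction factor used both for the injectivity of [Psi] on the torus and for the Neumann
    series. Only continuous complex differentiability is assumed, and the contour integral is
    replaced by averages over roots of unity. The norm of [b] is at most twice that of [w],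
    uniformly on the torus. The frequencies grow at most like the weights, being the values of a
    bounded functional at unit vectors, so their pairing with [b] converges absolutely. But the tail
    of this series depends on the point through [b], which is controlled only in norm. So one
    truncation cannot serve a whole time interval, and the clocks of remote coordinates have to lag
    behind. The lag is harmless in the end: up to a prescribed error, a coordinate of [Psi] on the
    torus depends on finitely many angles only. *)

Lemma normc_cabs c : `|c| = (cabs c)%:C.
Proof. by rewrite /cabs normc_def. Qed.

Lemma cabs_ge0 c : 0 <= cabs c.
Proof. by rewrite -lecR -normc_cabs; exact: normr_ge0. Qed.

Lemma cabsM c d : cabs (c * d) = cabs c * cabs d.
Proof. by apply/(@complexI R); rewrite -normc_cabs normrM !normc_cabs -rmorphM. Qed.

Lemma ler_cabsD c d : cabs (c + d) <= cabs c + cabs d.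
Proof. by rewrite -lecR rmorphD /= -!normc_cabs ler_normD. Qed.

Lemma cabsN c : cabs (- c) = cabs c.
Proof. by rewrite /cabs normrN. Qed.

Lemma ler_cabsB c d : cabs (c - d) <= cabs c + cabs d.
Proof. by rewrite -(cabsN d) ler_cabsD. Qed.

Lemma cabsR (x : R) : cabs x%:C = `|x|.
Proof. by rewrite /cabs normc_def /= expr0n addr0 sqrtr_sqr. Qed.

Lemma cabs0 : cabs (0 : R[i]) = 0.
Proof. by rewrite /cabs normr0. Qed.

Lemma cabs1 : cabs (1 : R[i]) = 1.
Proof. by rewrite /cabs normr1. Qed.

Lemma cabsV c : cabs c^-1 = (cabs c)^-1.
Proof.
have [->|c0] := eqVneq c 0; first by rewrite invr0 cabs0 invr0.
apply/(@complexI R); rewrite -normc_cabs normfV !normc_cabs.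
by rewrite [in RHS]fmorphV.
Qed.

Lemma cabs_eq0 c : cabs c = 0 -> c = 0.
Proof. by move=> c0; apply/eqP; rewrite -normr_eq0 normc_cabs c0. Qed.

Lemma cabs_gt0 c : c != 0 -> 0 < cabs c.
Proof.
move=> c0; rewrite lt_neqAle cabs_ge0 andbT eq_sym.
by apply: contraNneq c0 => /cabs_eq0 ->.
Qed.

Lemma Re_le_cabs c : `|complex.Re c| <= cabs c.
Proof. by rewrite -lecR -normc_cabs normc_ge_Re. Qed.

Lemma Im_le_cabs c : `|complex.Im c| <= cabs c.
Proof.
rewrite (_ : complex.Im c = complex.Re (- 'i%C * c)); last first.
  by case: c => a b /=; ring.
apply: (le_trans (Re_le_cabs _)); rewrite cabsM cabsN.
by rewrite (_ : cabs 'i = 1) ?mul1r // /cabs normc_def /= expr0n add0r expr1n sqrtr1.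
Qed.

Lemma cabs_le_ReIm c : cabs c <= `|complex.Re c| + `|complex.Im c|.
Proof.
rewrite [X in cabs X]complexE; apply: (le_trans (ler_cabsD _ _)).
rewrite cabsM !cabsR lerD2l.
by rewrite (_ : cabs 'i = 1) ?mul1r // /cabs normc_def /= expr0n add0r expr1n sqrtr1.
Qed.

Lemma ler_cabs_sum (I : Type) (r : seq I) (P : pred I) (F : I -> R[i]) :
  cabs (\sum_(i <- r | P i) F i) <= \sum_(i <- r | P i) cabs (F i).
Proof.
elim/big_rec2: _ => [|i y x _ yx]; first by rewrite cabs0.
by apply: (le_trans (ler_cabsD _ _)); rewrite lerD2l.
Qed.

(** A multiplier that norms [c]. It reduces the mean value inequality to a real function and the
    weighted l^1 norm to linear functionals. *)
Lemma cabs_dual c : exists2 u : R[i], cabs u <= 1 & u * c = (cabs c)%:C.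
Proof.
have [->|c0] := eqVneq c 0; first by exists 0; rewrite ?mulr0 cabs0.
exists (`|c| / c); last by rewrite divfK // normc_cabs.
by rewrite normc_cabs cabsM cabsV cabsR ger0_norm ?cabs_ge0 // divff // gt_eqF ?cabs_gt0.
Qed.

Lemma complex_gt0 c : 0 < c -> exists2 e : R, 0 < e & c = e%:C.
Proof.
move=> c0; exists (cabs c); first by rewrite cabs_gt0 // gt_eqF.
by rewrite -normc_cabs gtr0_norm.
Qed.

Lemma cabs_le0 c : (forall e : R, 0 < e -> cabs c <= e) -> c = 0.
Proof.
move=> h; apply: cabs_eq0; apply/eqP; rewrite eq_le cabs_ge0 andbT.
by apply/ler_addgt0Pl => e /h; rewrite addr0.
Qed.

Lemma cvg_cabsP (T : Type) (F : set_system T) (FF : Filter F) (f : T -> Cx R) (l : Cx R) :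
  (f @ F --> l) <-> (forall e : R, 0 < e -> \forall x \near F, cabs (l - f x) < e).
Proof.
split=> [/cvgrPdist_lt h e e0|h].
  have := h e%:C; rewrite ltcR => /(_ e0).
  by apply: filterS => x; rewrite normc_cabs ltcR.
apply/cvgrPdist_lt => e /complex_gt0[e' e'0 ->].
by apply: filterS (h _ e'0) => x; rewrite normc_cabs ltcR.
Qed.

Lemma Cx_hausdorff : hausdorff_space (Cx R).
Proof. exact: norm_hausdorff. Qed.

Lemma derive1_eq (f : Cx R -> Cx R) (x l : Cx R) :
  (forall e : R, 0 < e -> exists2 d : R, 0 < d &
     forall h : Cx R, cabs h < d -> cabs (f (x + h) - f x - h * l) <= e * cabs h) ->
  derive1 f x = l.
Proof.
move=> h; rewrite /derive1; apply: cvg_lim; first exact: Cx_hausdorff.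
apply/cvg_cabsP => e e0.
have [d d0 hd] := h (e / 2) ltac:(by rewrite divr_gt0).
have d0' : 0 < d%:C :> Cx R by rewrite ltcR.
near=> t.
have td : cabs t < d.
  by rewrite -ltcR -normc_cabs; near: t; exact: dnbhs0_lt.
have t0 : t != 0 :> Cx R by near: t; exact: nbhs_dnbhs_neq.
have tg : 0 < cabs t by exact: cabs_gt0.
have -> : l - t^-1 *: (f (t + x) - f x) = - (t^-1 * (f (x + t) - f x - t * l)).
  by rewrite (addrC t x) -[_ *: _]/(_ * _); field.
rewrite cabsN cabsM cabsV mulrC ltr_pdivrMr //.
by apply: (le_lt_trans (hd _ td)); rewrite ltr_pM2r // gtr_pMr // invf_lt1 // ltr1n.
Unshelve. all: by end_near. Qed.

Lemma has_deriv_eps (f : R -> Cx R) (l : Cx R) (t : R) :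
  (forall e : R, 0 < e -> exists2 d : R, 0 < d &
     forall h : R, `|h| < d -> cabs (f (t + h) - f t - h%:C * l) <= e * `|h|) ->
  has_deriv f l t.
Proof.
move=> H.
(* [Re] and [Im] are treated at once, as additive, real-homogeneous functionals bounded by the
   modulus. *)
have key (p : {additive R[i] -> R}) : (forall (x : R) c, p (x%:C * c) = x * p c) ->
    (forall c, `|p c| <= cabs c) -> is_derive t (1 : R) (fun x => p (f x)) (p l).
  move=> pM ple.
  have : (fun h : R => h^-1 *: ((fun x => p (f x)) (h *: (1 : R) + t) - p (f t)))
      @ 0^' --> p l.
    apply/cvgrPdist_lt => e e0.
    have [d d0 hd] := H (e / 2) ltac:(by rewrite divr_gt0).
    near=> h.
    have hdd : `|h| < d by near: h; exact: dnbhs0_lt.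
    have h0 : h != 0 by near: h; exact: nbhs_dnbhs_neq.
    have hg : 0 < `|h| by rewrite normr_gt0.
    have -> : p l - h^-1 *: (p (f (h *: 1 + t)) - p (f t))
         = - (h^-1 * p (f (t + h) - f t - h%:C * l)).
      rewrite (_ : p (_ - h%:C * _) = p (f (t + h)) - p (f t) - h * p l); last first.
        by rewrite 2!raddfB /= pM.
      rewrite -[h%:A]/(h * 1) mulr1 (addrC t h).
      have E (a b c : R) : c - h^-1 * (a - b) = - (h^-1 * (a - b - h * c)) by field.
      exact: E.
    rewrite normrN normrM normfV mulrC ltr_pdivrMr //.
    apply: (le_lt_trans (ple _)); apply: (le_lt_trans (hd _ hdd)).
    by rewrite ltr_pM2r // gtr_pMr // invf_lt1 // ltr1n.
  move=> hc; apply: DeriveDef; first by apply/cvg_ex; exists (p l).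
  exact: cvg_lim hc.
split.
- apply: (key (@complex.Re R : {additive R[i] -> R})) => [x c|c].
    by case: c => a b; rewrite /= mul0r subr0.
  exact: Re_le_cabs.
- apply: (key (@complex.Im R : {additive R[i] -> R})) => [x c|c].
    by case: c => a b; rewrite /= mul0r addr0.
  exact: Im_le_cabs.
Unshelve. all: by end_near. Qed.

End ComplexModulus.

(** * Sums over the integers *)

Section WindowSums.
Variable V : nmodType.
Implicit Type F G : int -> V.

(** [zpartial] with values in any commutative monoid, so that the same identities serve complex
    series and their real majorants. *)
Definition zwin F (N : nat) : V := \sum_(k < (2 * N).+1) F (k%:Z - N%:Z).

Lemma zwin0 F : zwin F 0 = F 0.
Proof. by rewrite /zwin big_ord_recl big_ord0 addr0 /= subr0. Qed.

Lemma zwinS F N : zwin F N.+1 = F (- N.+1%:Z) + zwin F N + F N.+1%:Z.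
Proof.
rewrite /zwin (_ : (2 * N.+1).+1 = (2 * N).+3)%N; last by rewrite mulnS.
rewrite big_ord_recl big_ord_recr /= addrA; congr (_ + _ + _).
- by congr F; lia.
- by apply: eq_bigr => k _; congr F; rewrite /bump /=; lia.
- by congr F; rewrite /bump /=; lia.
Qed.

Lemma eq_zwin F G N : (forall i : int, (`|i| <= N)%N -> F i = G i) ->
  zwin F N = zwin G N.
Proof. by move=> FG; apply: eq_bigr => k _; apply: FG; have := ltn_ord k; lia. Qed.

Lemma zwinD F G N : zwin (fun i => F i + G i) N = zwin F N + zwin G N.
Proof. exact: big_split. Qed.

Lemma zwin_stable F N M : (forall i : int, (N < `|i|)%N -> F i = 0) ->
  (N <= M)%N -> zwin F M = zwin F N.
Proof.
move=> F0 /subnKC <-; elim: (M - N)%N => [|d IH]; first by rewrite addn0.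
by rewrite addnS zwinS IH !F0 ?addr0 ?add0r //; lia.
Qed.

Lemma zwin_single F (j : int) N : (forall i, i != j -> F i = 0) -> (`|j| <= N)%N ->
  zwin F N = F j.
Proof.
move=> F0 jN; have h : (`|(j + N%:Z)%R| < (2 * N).+1)%N by lia.
have E : `|(j + N%:Z)%R|%N%:Z - N%:Z = j by lia.
rewrite /zwin (bigD1 (Ordinal h)) //= E big1 ?addr0 // => k kh.
apply: F0; apply: contra_neq kh => kj; apply: val_inj => /=; lia.
Qed.

End WindowSums.

Section RealWindowSums.
Variable R : realType.
Implicit Type F G : int -> R.

Lemma zwinZ (c : R) F N : zwin (fun i => c * F i) N = c * zwin F N.
Proof. by rewrite /zwin mulr_sumr. Qed.

Lemma ler_zwin F G N : (forall i, F i <= G i) -> zwin F N <= zwin G N.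
Proof. by move=> FG; apply: ler_sum => k _; exact: FG. Qed.

Lemma zwin_ge0 F N : (forall i, 0 <= F i) -> 0 <= zwin F N.
Proof. by move=> F0; apply: sumr_ge0 => k _; exact: F0. Qed.

Lemma zwin_homo F N M : (forall i, 0 <= F i) -> (N <= M)%N ->
  zwin F N <= zwin F M.
Proof.
move=> F0 /subnKC <-; elim: (M - N)%N => [|d IH]; first by rewrite addn0.
by rewrite addnS zwinS (le_trans IH) // -addrA ler_wpDl // lerDl.
Qed.

Lemma zwin_ge_term F (i : int) N : (forall i, 0 <= F i) -> (`|i| <= N)%N ->
  F i <= zwin F N.
Proof.
move=> F0 iN; have h : (`|(i + N%:Z)%R| < (2 * N).+1)%N by lia.
rewrite /zwin (bigD1 (Ordinal h)) //=.
rewrite (_ : `|(i + N%:Z)%R|%N%:Z - N%:Z = i); last by lia.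
by rewrite lerDl sumr_ge0.
Qed.

(** Windows are finite and every finite set of integers lies in a window; since the terms are
    nonnegative, the unordered sum is the supremum of the windows. *)
Lemma esum_zwinP F (C : R) : (forall i, 0 <= F i) ->
  (\esum_(j in [set: int]) (F j)%:E <= C%:E)%E <-> (forall N, zwin F N <= C).
Proof.
move=> F0; have winE N : exists s : seq int, [/\ uniq s, zwin F N = \sum_(i <- s) F i &
    forall i : int, (`|i| <= N)%N -> i \in s].
  exists [seq k%:Z - N%:Z | k <- iota 0 (2 * N).+1]; split.
  - rewrite map_inj_uniq ?iota_uniq // => a b; lia.
  - by rewrite big_map /zwin -(big_mkord xpredT (fun k : nat => F (k%:Z - N%:Z))) /index_iota subn0.
  - move=> i iN; apply/mapP; exists `|(i + N%:Z)%R|%N; last by lia.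
    by rewrite mem_iota; lia.
split=> [h N|h].
- have [s [us -> _]] := winE N.
  rewrite -lee_fin; apply: le_trans h; apply: esum_ge.
  exists [set` s]; first by split => //; exact: finite_seq.
  by rewrite -sumEFin fsbig_seq.
- apply: ge_ereal_sup => _ [A [fA _] <-].
  pose N := \max_(i <- finmap.enum_fset (fset_set A)) `|i|%N.
  have [s [us sE sN]] := winE N.
  apply: (@le_trans _ _ (zwin F N)%:E); last by rewrite lee_fin.
  rewrite sE -sumEFin [leRHS]fsbig_seq //; apply: lee_fsum_nneg_subset => //.
  + move=> i; rewrite !inE => Ai; apply: sN.
    by apply: (@leq_bigmax_seq _ _ xpredT (fun i : int => `|i|%N)) => //; rewrite in_fset_set // inE.
  + by move=> i _; rewrite lee_fin.
Qed.

Lemma zwin_tail F (C : R) : (forall i, 0 <= F i) -> (forall N, zwin F N <= C) ->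
  forall e, 0 < e -> exists N, forall M, (N <= M)%N -> zwin F M - zwin F N <= e.
Proof.
move=> F0 FC e e0.
(* The tail starts at a window within [e] of the supremum of all windows. *)
have hs : has_sup (range (zwin F)).
  by split; [exists (zwin F 0), 0%N | exists C => _ [N _ <-]].
have [_ [N _ <-] hN] := sup_adherent e0 hs.
exists N => M NM; rewrite lerBlDr -lerBlDl.
apply: le_trans (ltW hN); rewrite lerD2r.
by apply: ub_le_sup; [case: hs | exists M].
Qed.

End RealWindowSums.

Section IntegerSums.
Variable R : realType.
Implicit Types F G : Seq R.

Lemma zpartialE F : zpartial F = zwin F. Proof. by []. Qed.

Lemma ler_cabs_zwin F N : cabs (zwin F N) <= zwin (fun i => cabs (F i)) N.
Proof. exact: ler_cabs_sum. Qed.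

Lemma ler_cabs_zwinB F N M : (N <= M)%N ->
  cabs (zwin F M - zwin F N)
    <= zwin (fun i => cabs (F i)) M - zwin (fun i => cabs (F i)) N.
Proof.
move=> /subnKC <-; elim: (M - N)%N => [|d IH]; first by rewrite addn0 !subrr cabs0.
rewrite addnS !zwinS.
rewrite (_ : _ - _ = F (- (N + d).+1%:Z) + (zwin F (N + d) - zwin F N)
  + F (N + d).+1%:Z); last by ring.
apply: (le_trans (ler_cabsD _ _)).
rewrite [leRHS]addrAC lerD2r -[leRHS]addrA.
by apply: (le_trans (ler_cabsD _ _)); rewrite lerD2l.
Qed.

Lemma cvgn_Cx (u : nat -> Cx R) :
  (forall e : R, 0 < e -> exists N, forall M, (N <= M)%N -> cabs (u M - u N) <= e) ->
  cvgn u.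
Proof.
move=> H.
have key (p : {additive R[i] -> R}) : (forall c, `|p c| <= cabs c) ->
    cvgn (fun n => p (u n)).
  move=> ple; apply/cauchy_cvgP/cauchy_exP => e e0.
  have [N hN] := H (e / 2) ltac:(by rewrite divr_gt0).
  exists (p (u N)), N => //= M /= NM; rewrite /ball /= distrC -raddfB /=.
  apply: (le_lt_trans (ple _)); apply: (le_lt_trans (hN _ NM)).
  by rewrite gtr_pMr // invf_lt1 // ltr1n.
have /cvg_ex[/= a ha] := key (@complex.Re R : {additive R[i] -> R}) (@Re_le_cabs R).
have /cvg_ex[/= b hb] := key (@complex.Im R : {additive R[i] -> R}) (@Im_le_cabs R).
apply/cvg_ex; exists (a +i* b : Cx R); apply/cvg_cabsP => e e0.
move/cvgrPdist_lt : ha => /(_ (e / 2)) ha; move/cvgrPdist_lt : hb => /(_ (e / 2)) hb.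
near=> n.
apply: (le_lt_trans (cabs_le_ReIm _)); rewrite !raddfB /= [ltRHS]splitr ltrD //.
  by near: n; apply: ha; rewrite divr_gt0.
by near: n; apply: hb; rewrite divr_gt0.
Unshelve. all: by end_near. Qed.

Lemma zcvg_abs F (C : R) : (forall N, zwin (fun i => cabs (F i)) N <= C) -> zcvg F.
Proof.
move=> FC; apply: cvgn_Cx => e e0.
have [N hN] := zwin_tail (fun i => cabs_ge0 (F i)) FC e0.
exists N => M NM; apply: le_trans (hN _ NM); exact: ler_cabs_zwinB.
Qed.

Lemma limn_close (u : nat -> Cx R) (c : Cx R) (C : R) N : cvgn u ->
  (forall M, (N <= M)%N -> cabs (u M - c) <= C) -> cabs (limn u - c) <= C.
Proof.
move=> /cvg_cabsP cu H; apply/ler_addgt0Pr => e e0.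
have [M _ hM] := cu e e0.
have h := hM (maxn N M) (leq_maxr N M).
rewrite (_ : _ - c = (limn u - u (maxn N M)) + (u (maxn N M) - c)); last by ring.
apply: (le_trans (ler_cabsD _ _)); rewrite addrC lerD ?(ltW h) //.
by apply: H; rewrite leq_maxl.
Qed.

Lemma zsum_le F (C : R) : (forall N, zwin (fun i => cabs (F i)) N <= C) ->
  cabs (zsum F) <= C.
Proof.
move=> FC; rewrite -[zsum F]subr0; apply: (@limn_close _ _ _ 0%N).
  exact: zcvg_abs FC.
by move=> M _; rewrite subr0; apply: (le_trans (ler_cabs_zwin _ _)).
Qed.

Lemma zsum_tail F (C : R) : (forall N, zwin (fun i => cabs (F i)) N <= C) ->
  forall e, 0 < e -> exists N, forall M, (N <= M)%N -> cabs (zsum F - zwin F M) <= e.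
Proof.
move=> FC e e0; have [N hN] := zwin_tail (fun i => cabs_ge0 (F i)) FC e0.
exists N => M NM; apply: (@limn_close _ _ _ M); first exact: zcvg_abs FC.
move=> K MK; apply: (le_trans (ler_cabs_zwinB _ MK)).
apply: le_trans (hN _ (leq_trans NM MK)); rewrite lerD2l lerN2.
by apply: zwin_homo => // i; exact: cabs_ge0.
Qed.

Lemma zsum_finite F N : (forall i : int, (N < `|i|)%N -> F i = 0) ->
  zsum F = zwin F N.
Proof.
move=> F0; apply: cvg_lim; first exact: Cx_hausdorff.
apply/cvg_cabsP => e e0; exists N => // M NM /=.
by rewrite zpartialE (zwin_stable F0 NM) subrr cabs0.
Qed.

Lemma eq_zsum F G : (forall i, F i = G i) -> zsum F = zsum G.
Proof. by move=> FG; congr zsum; apply/funext. Qed.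

Lemma zsum0 F : (forall i, F i = 0) -> zsum F = 0.
Proof.
move=> F0; rewrite (@zsum_finite _ 0%N) ?zwin0 // => i _; exact: F0.
Qed.

(* Also if the series diverges: both sides are then the default value 0. *)
Lemma zsumZ (c : Cx R) F : zsum (fun i => c * F i) = c * zsum F.
Proof.
have [->|c0] := eqVneq c 0.
  by rewrite mul0r; apply: zsum0 => i; rewrite mul0r.
have E (d : Cx R) G : zpartial (fun i => d * G i) = (fun N => d * zpartial G N).
  by apply/funext => N; rewrite /zpartial mulr_sumr.
have [FC|FC] := pselect (zcvg F); first by rewrite /zsum E; exact: limZr.
have cFC : ~ zcvg (fun i => c * F i).
  move=> cF; apply: FC.
  have -> : F = fun i => c^-1 * (c * F i) by apply/funext => i; rewrite mulKf.
  by rewrite /zcvg E; exact: (is_cvgZr cF).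
have pt : (point : Cx R) = 0 by [].
rewrite (_ : zsum F = 0); last by rewrite -pt; exact: (dvgP FC).
by rewrite mulr0 -pt; exact: (dvgP cFC).
Qed.

Lemma zsumB F G : zcvg F -> zcvg G -> zsum (fun i => F i - G i) = zsum F - zsum G.
Proof.
move=> cF cG; rewrite -[RHS](limB cF cG) /zsum.
rewrite (_ : zpartial _ = zpartial F - zpartial G) //.
by apply/funext => N; rewrite /zpartial sumrB.
Qed.

Lemma eq_zsumB F1 F2 G1 G2 : zcvg F1 -> zcvg F2 -> zcvg G1 -> zcvg G2 ->
  (forall i, F1 i - F2 i = G1 i - G2 i) -> zsum F1 - zsum F2 = zsum G1 - zsum G2.
Proof. by move=> ? ? ? ? FG; rewrite -!zsumB //; exact: eq_zsum. Qed.

End IntegerSums.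

(** * Norms on the phase space *)

Section PhaseNorms.
Variables (R : realType) (alpha : R).
Implicit Types (x y : Seq R) (u v z : Phase R) (th : int -> R).

Local Notation weight := (weight alpha).
Local Notation norm1 := (norm1 alpha).
Local Notation normP := (normP alpha).
Local Notation dom := (dom alpha).
Local Notation "u '<=P' C" := (normP u%R <= (C%R)%:E)%E (at level 70).

Lemma weight_ge1 j : 1 <= weight j.
Proof. by rewrite -expR0 ler_expR powR_ge0. Qed.

Lemma weight_gt0 j : 0 < weight j.
Proof. exact: expR_gt0. Qed.

Lemma weight_ge0 j : 0 <= weight j.
Proof. exact: expR_ge0. Qed.

(** For |j| >= 1 one has |j| <= e^|j| <= e^(|j|^(1+alpha)). This growth makes a displacement by less
    than 2 pi small compared with the weight of a far coordinate. *)
Lemma weight_ge_abs j : 0 < alpha -> (`|j|%N%:R : R) <= weight j.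
Proof.
move=> a0; have [->|j0] := eqVneq j 0; first by rewrite (le_trans _ (weight_ge1 _)).
have h : 1 <= (`|j|%N%:R : R) by rewrite ler1n; lia.
apply: (@le_trans _ _ (expR (`|j|%N%:R))).
  by apply: le_trans (expR_ge1Dx _); rewrite lerDr.
by rewrite ler_expR -[leLHS]powRr1 // ler_powR // lerDl ltW.
Qed.

Lemma norm1_leP x (C : R) :
  (norm1 x <= C%:E)%E <-> forall N, zwin (fun j => cabs (x j) * weight j) N <= C.
Proof.
by apply: esum_zwinP => i; rewrite mulr_ge0 ?cabs_ge0 ?weight_ge0.
Qed.

Lemma norm_sup_leP x (C : R) :
  (norm_sup x <= C%:E)%E <-> forall j, cabs (x j) <= C.
Proof.
split=> [h j|h]; first by rewrite -lee_fin; apply: le_trans h; apply: ereal_sup_ubound; exists j.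
by apply: ge_ereal_sup => _ [j _ <-]; rewrite lee_fin.
Qed.

Lemma normP_leP u (C : R) : (u <=P C) <->
  (norm1 u.1 <= C%:E)%E /\ (norm_sup u.2 <= C%:E)%E.
Proof. by rewrite /normP ge_max; split=> [/andP|[-> ->]]. Qed.

Lemma norm1_ge0 x : (0 <= norm1 x)%E.
Proof.
by apply: esum_ge0 => j _; rewrite lee_fin mulr_ge0 ?cabs_ge0 ?weight_ge0.
Qed.

Lemma norm_sup_ge0 x : (0 <= norm_sup x)%E.
Proof.
apply: (@le_trans _ _ (cabs (x 0))%:E); first by rewrite lee_fin cabs_ge0.
by apply: ereal_sup_ubound; exists 0.
Qed.

Lemma normP_ge0 u : (0 <= normP u)%E.
Proof. by rewrite /normP le_max norm1_ge0. Qed.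

Lemma normP_fin u : (normP u < +oo)%E -> exists2 C : R, 0 < C & (u <=P C).
Proof.
have := normP_ge0 u; case: (normP u) => [a| |] // a0 _.
exists (a + 1); first by rewrite ltr_wpDl.
by rewrite lee_fin lerDl.
Qed.

Lemma normP_fin_eq u : (normP u < +oo)%E -> exists2 a : R, 0 <= a & normP u = a%:E.
Proof. by have := normP_ge0 u; case: (normP u) => [a| |] // a0 _; exists a. Qed.

Lemma ltoo_le (a : \bar R) (C : R) : (a <= C%:E)%E -> (a < +oo)%E.
Proof. by move=> h; apply: le_lt_trans h _; exact: ltry. Qed.

Lemma norm1_term x (C : R) j : (norm1 x <= C%:E)%E -> cabs (x j) * weight j <= C.
Proof.
move/norm1_leP/(_ `|j|%N); apply: le_trans; apply: (zwin_ge_term (F := fun j => _)) => // i.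
by rewrite mulr_ge0 ?cabs_ge0 ?weight_ge0.
Qed.

Lemma norm1_coord x (C : R) j : (norm1 x <= C%:E)%E -> cabs (x j) <= C.
Proof.
move/(norm1_term j); apply: le_trans.
by rewrite ler_peMr ?cabs_ge0 // weight_ge1.
Qed.

Lemma normPD u v (a b : R) : (u <=P a) -> (v <=P b) ->
  (u + v <=P a + b).
Proof.
move=> /normP_leP[/norm1_leP u1 /norm_sup_leP u2] /normP_leP[/norm1_leP v1 /norm_sup_leP v2].
apply/normP_leP; split; [apply/norm1_leP => N|apply/norm_sup_leP => j].
- apply: le_trans (lerD (u1 N) (v1 N)); rewrite -zwinD; apply: ler_zwin => j.
  by rewrite -mulrDl ler_wpM2r ?ler_cabsD // weight_ge0.
- exact: le_trans (ler_cabsD _ _) (lerD (u2 j) (v2 j)).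
Qed.

Lemma normPZ u (c : R[i]) (a : R) : (u <=P a) ->
  (c *: u <=P cabs c * a).
Proof.
move=> /normP_leP[/norm1_leP u1 /norm_sup_leP u2].
apply/normP_leP; split; [apply/norm1_leP => N|apply/norm_sup_leP => j].
- rewrite (_ : zwin _ N = cabs c * zwin (fun j => cabs (u.1 j) * weight j) N).
    by rewrite ler_wpM2l ?cabs_ge0.
  by rewrite -zwinZ; apply: eq_zwin => i _; rewrite mulrA -cabsM.
- by rewrite (_ : cabs _ = cabs c * cabs (u.2 j)) ?ler_wpM2l ?cabs_ge0 // -cabsM.
Qed.

Lemma normPN u (a : R) : (u <=P a) -> (- u <=P a).
Proof. by move/(@normPZ _ (-1)); rewrite scaleN1r cabsN cabs1 mul1r. Qed.

Lemma normPB u v (a b : R) : (u <=P a) -> (v <=P b) ->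
  (u - v <=P a + b).
Proof. by move=> ua /normPN; exact: normPD. Qed.

Lemma norm1_0 : norm1 0 = 0%E.
Proof.
by apply/eqP; rewrite eq_le norm1_ge0 andbT; apply/norm1_leP => N;
  rewrite (@zwin_stable _ _ 0%N) ?zwin0 // => [|i _]; rewrite cabs0 mul0r.
Qed.

Lemma norm_sup0 : norm_sup (0 : Seq R) = 0%E.
Proof.
by apply/eqP; rewrite eq_le norm_sup_ge0 andbT; apply/norm_sup_leP => j; rewrite cabs0.
Qed.

Lemma normP0 : normP 0 = 0%E.
Proof. by rewrite /normP norm1_0 norm_sup0 maxxx. Qed.

Lemma normP_eq0 u : (forall e : R, 0 < e -> (u <=P e)) -> u = 0.
Proof.
move=> h; case: u h => u1 u2 h; congr (_, _); apply/funext => j;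
  apply: cabs_le0 => e /h /normP_leP[h1 /norm_sup_leP h2] //.
exact: norm1_coord h1.
Qed.

Lemma normP_angle y (C : R) : 0 <= C -> ((0, y) <=P C) <-> forall j, cabs (y j) <= C.
Proof.
move=> C0; split; first by move/normP_leP => [_ /norm_sup_leP].
by move=> h; apply/normP_leP; rewrite norm1_0 lee_fin; split => //; apply/norm_sup_leP.
Qed.

Lemma normP_action x (C : R) : (norm1 x <= C%:E)%E -> ((x, 0) <=P C).
Proof.
move=> h; apply/normP_leP; rewrite norm_sup0 lee_fin; split => //.
by rewrite -lee_fin (le_trans _ h) // norm1_ge0.
Qed.

Lemma norm1_unit j : (norm1 (unit_seq R j) <= (weight j)%:E)%E.
Proof.
pose F i := cabs (unit_seq R j i) * weight i.
have F0 i : i != j -> F i = 0 by move=> /negPf ij; rewrite /F /unit_seq ij cabs0 mul0r.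
have Fj : F j = weight j by rewrite /F /unit_seq eqxx cabs1 mul1r.
apply/norm1_leP => N; rewrite -Fj -(@zwin_single _ F j (maxn N `|j|%N) F0) ?leq_maxr //.
apply: zwin_homo; rewrite ?leq_maxl // => i.
by rewrite mulr_ge0 ?cabs_ge0 ?weight_ge0.
Qed.

Lemma norm_sup_unit j : (norm_sup (unit_seq R j) <= 1%:E)%E.
Proof.
apply/norm_sup_leP => i; rewrite /unit_seq; case: eqP => _; by rewrite ?cabs1 ?cabs0.
Qed.

Lemma norm1_fin x (C : R) : (norm1 x < C%:E)%E -> exists2 a : R, a < C & (norm1 x <= a%:E)%E.
Proof.
have := norm1_ge0 x; case: (norm1 x) => [a| |] // _.
by rewrite lte_fin => aC; exists a.
Qed.

Lemma im_sup_ltP x (C : R) : (im_sup x < C%:E)%E <->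
  exists2 a : R, a < C & forall j, `|complex.Im (x j)| <= a.
Proof.
have ub j : (`|complex.Im (x j)|%:E <= im_sup x)%E.
  by apply: ereal_sup_ubound; exists j.
split=> [|[a aC h]]; last first.
  apply: (@le_lt_trans _ _ a%:E); last by rewrite lte_fin.
  by apply: ge_ereal_sup => _ [j _ <-]; rewrite lee_fin.
have := le_trans (_ : 0 <= `|complex.Im (x 0)|%:E)%E (ub 0); rewrite lee_fin normr_ge0 => /(_ isT).
case E : (im_sup x) => [a| |] // _; rewrite lte_fin => aC; exists a => // j.
by rewrite -lee_fin -E.
Qed.

Lemma dom_open c (s r : R) z : dom c s r z ->
  exists2 d : R, 0 < d & forall v, (v <=P d) -> dom c s r (z + v).
Proof.
move=> [/norm1_fin[a as_ /norm1_leP az] /im_sup_ltP[b br bz]].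
pose d := Num.min ((s - a) / 2) ((r - b) / 2).
have d1 : d <= (s - a) / 2 by rewrite ge_min lexx.
have d2 : d <= (r - b) / 2 by rewrite ge_min lexx orbT.
exists d; first by rewrite lt_min !divr_gt0 // subr_gt0.
move=> v /normP_leP[/norm1_leP v1 /norm_sup_leP v2]; split.
- apply: (@le_lt_trans _ _ (a + d)%:E); last by rewrite lte_fin; lra.
  apply/norm1_leP => N; apply: le_trans (lerD (az N) (v1 N)); rewrite -zwinD.
  apply: ler_zwin => j; rewrite -mulrDl ler_wpM2r ?weight_ge0 //.
  by rewrite (_ : (_ - c) j = (z.1 - c) j + v.1 j) ?ler_cabsD //= !fctE addrAC.
- apply/im_sup_ltP; exists (b + d); first by lra.
  move=> j /=; rewrite raddfD; apply: (le_trans (ler_normD _ _)); rewrite lerD //.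
    exact: bz.
  exact: le_trans (Im_le_cabs _) (v2 j).
Qed.

(** The complex ball around a torus point has the same radius everywhere on the torus, so Cauchy's
    estimate will be uniform in the angles. *)
Lemma dom_near_torus c (s r d : R) th v : 0 <= d -> d < s -> d < r -> (v <=P d) ->
  dom c s r ((c, of_angle th) + v).
Proof.
move=> d0 ds dr /normP_leP[v1 /norm_sup_leP v2]; split.
- by rewrite /= addrAC subrr add0r; apply: (le_lt_trans v1); rewrite lte_fin.
- apply/im_sup_ltP; exists d => // j /=; rewrite raddfD /= add0r.
  exact: le_trans (Im_le_cabs _) (v2 j).
Qed.

Lemma dom_torus c (s r : R) th : 0 < s -> 0 < r -> dom c s r (c, of_angle th).
Proof.
move=> s0 r0; rewrite -[X in dom _ _ _ X]addr0; apply: (@dom_near_torus _ _ _ 0) => //.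
by rewrite normP0.
Qed.

End PhaseNorms.

(** * A Cauchy estimate *)

Section Derivatives.
Variable R : realType.
Implicit Types (f : R -> Cx R) (l : Cx R).

Lemma has_derivD f1 f2 l1 l2 (t : R) : has_deriv f1 l1 t -> has_deriv f2 l2 t ->
  has_deriv (fun x => f1 x + f2 x) (l1 + l2) t.
Proof.
move=> [a1 b1] [a2 b2]; split.
- rewrite raddfD; have := is_deriveD a1 a2; congr (is_derive _ _ _ _).
  by apply/funext => x; rewrite raddfD.
- rewrite raddfD; have := is_deriveD b1 b2; congr (is_derive _ _ _ _).
  by apply/funext => x; rewrite raddfD.
Qed.

Lemma has_deriv_cst l (t : R) : has_deriv (fun=> l) 0 t.
Proof. by split; exact: is_derive_cst. Qed.

Lemma has_deriv_sum (n : nat) (f : 'I_n -> R -> Cx R) (l : 'I_n -> Cx R) (t : R) :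
  (forall k, has_deriv (f k) (l k) t) ->
  has_deriv (fun x => \sum_k f k x) (\sum_k l k) t.
Proof.
elim: n f l => [|n IH] f l H.
  rewrite big_ord0; have := @has_deriv_cst 0 t; congr (has_deriv _ _ _).
  by apply/funext => x; rewrite big_ord0.
rewrite big_ord_recl.
have := has_derivD (H ord0) (IH _ _ (fun k => H (lift ord0 k))).
by congr (has_deriv _ _ _); apply/funext => x; rewrite big_ord_recl.
Qed.

(** Quotient rule for f(x)/x, to be applied to a circle average divided by the radius. *)
Lemma has_deriv_inv f l (t : R) : t != 0 -> has_deriv f l t ->
  has_deriv (fun x => (x^-1)%:C * f x) ((t^-1)%:C * l - (t ^- 2)%:C * f t) t.
Proof.
move=> t0 [a b].
have key (p : R -> R) (dp : R) : is_derive t (1 : R) p dp ->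
    is_derive t (1 : R) (fun x => x^-1 * p x) (t^-1 * dp - t ^- 2 * p t).
  move=> pd; have := is_deriveM (is_deriveV t0 (is_derive_id t (1 : R))) pd.
  by rewrite (_ : _ *: _ + _ = t^-1 * dp - t ^- 2 * p t) // /GRing.scale /=; ring.
split.
- have := key _ _ a; rewrite (_ : complex.Re (_ - _) = t^-1 * complex.Re l - t ^- 2 * complex.Re (f t)).
    congr (is_derive _ _ _ _); apply/funext => x.
    by case: (f x) => ? ? /=; ring.
  by case: (f t) => ? ?; case: (l) => ? ? /=; ring.
- have := key _ _ b; rewrite (_ : complex.Im (_ - _) = t^-1 * complex.Im l - t ^- 2 * complex.Im (f t)).
    congr (is_derive _ _ _ _); apply/funext => x.
    by case: (f x) => ? ? /=; ring.
  by case: (f t) => ? ?; case: (l) => ? ? /=; ring.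
Qed.

Lemma mean_value_bound f (df : R -> Cx R) (C a b : R) : a <= b ->
  (forall x, a <= x <= b -> has_deriv f (df x) x /\ cabs (df x) <= C) ->
  cabs (f b - f a) <= C * (b - a).
Proof.
rewrite le_eqVlt => /predU1P[<-|ab] H; first by rewrite !subrr mulr0 cabs0.
(* Rotating the total increment onto the positive real axis makes it the increment of a real
   function, to which the real mean value theorem applies. *)
have [u u1 ue] := cabs_dual (f b - f a).
pose p (c : Cx R) : R := complex.Re (u * c).
have gd x : a <= x <= b -> is_derive x (1 : R) (fun x => p (f x)) (p (df x)).
  move=> /H[[fr fi] _].
  have E c : p c = complex.Re u * complex.Re c - complex.Im u * complex.Im c.
    by rewrite /p; case: (u) => ? ?; case: c.
  have := is_deriveB (is_deriveZ (complex.Re u) fr) (is_deriveZ (complex.Im u) fi).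
  rewrite E; congr (is_derive _ _ _ _).
  by apply/funext => y; rewrite E.
have [||c hc] := @MVT R (fun x => p (f x)) (fun x => p (df x)) a b ab _.
  by move=> x; rewrite in_itv /= => /andP[x1 x2]; apply: gd; rewrite !ltW.
  apply: derivable_within_continuous => x; rewrite in_itv /= => hx.
  by case: (gd _ hx).
move=> E; have {E} : cabs (f b - f a) = p (df c) * (b - a).
  by rewrite -E /p -raddfB /= -mulrBr ue.
move=> ->; move: hc; rewrite in_itv /= => /andP[c1 c2].
rewrite ler_wpM2r ?subr_ge0 ?(ltW ab) //.
apply: (le_trans (ler_norm _)); apply: (le_trans (Re_le_cabs _)).
rewrite cabsM; have [_] := H c (introT andP (conj (ltW c1) (ltW c2))).
by apply: le_trans; rewrite ler_piMl // cabs_ge0.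
Qed.

End Derivatives.

(** * Cauchy's estimate from averages over roots of unity *)

Section CauchyEstimate.
Variable R : realType.

Lemma root_of_unity_near1 (d : R) : 0 < d -> exists (n : nat) (zeta : Cx R),
  [/\ (0 < n)%N, zeta ^+ n = 1, zeta != 1, cabs zeta = 1 & cabs (zeta - 1) < d].
Proof.
move=> d0.
have hc : (fun x : R => cos x) x @[x --> (0 : R)] --> (1 : R).
  by rewrite -cos0; exact: continuous_cos.
have hs : (fun x : R => sin x) x @[x --> (0 : R)] --> (0 : R).
  by rewrite -{2}sin0; exact: continuous_sin.
move/cvgrPdist_lt : hc => /(_ (d / 2)); rewrite divr_gt0 // => /(_ isT)[e1 /= e10 h1].
move/cvgrPdist_lt : hs => /(_ (d / 2)); rewrite divr_gt0 // => /(_ isT)[e2 /= e20 h2].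
have pi0 := pi_gt0 R.
pose e := Num.min e1 e2; have e0 : 0 < e by rewrite lt_min e10.
(* At least 3, so that t < pi; then sin t > 0 and [zeta != 1]. *)
pose n := (Num.bound (2 * pi / e)).+3.
have n0 : 0 < n%:R :> R by rewrite ltr0n.
have n3 : 3 <= n%:R :> R by rewrite ler_nat.
pose t : R := 2 * pi / n%:R.
have t0 : 0 < t by rewrite divr_gt0 // mulr_gt0.
have tpi : t < pi by rewrite ltr_pdivrMr // mulrC ltr_pM2l //; lra.
have te : t < e.
  have b : 2 * pi / e < n%:R.
    apply: (lt_le_trans (archi_boundP (ltW (divr_gt0 (mulr_gt0 (ltr0Sn R 1) pi0) e0)))).
    by rewrite ler_nat; exact: (leq_addl 3).
  by rewrite /t ltr_pdivrMr // [e * _]mulrC -ltr_pdivrMr.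
have te1 : t < e1 by move: te; rewrite lt_min => /andP[].
have te2 : t < e2 by move: te; rewrite lt_min => /andP[].
have E k : (cos t +i* sin t : Cx R) ^+ k = cos (k%:R * t) +i* sin (k%:R * t).
  elim: k => [|k IH]; first by rewrite expr0 mul0r cos0 sin0.
  rewrite exprSr IH -natr1 mulrDl mul1r cosD sinD.
  by apply/eqP; rewrite eq_complex /=; apply/andP; split; apply/eqP; ring.
exists n, (cos t +i* sin t); split => //.
- rewrite E /t mulrCA mulfV ?gt_eqF // mulr1.
  by rewrite mulrC mulr_natr cos2pi sin2pi.
- rewrite eq_complex /= negb_and orbC gt_eqF //; apply: sin_gt0_pi.
  by rewrite t0.
- by rewrite /cabs normc_def /= cos2Dsin2 sqrtr1.
- apply: (le_lt_trans (cabs_le_ReIm _)); rewrite [ltRHS]splitr /= ltrD //.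
    by rewrite distrC; apply: h1; rewrite /= sub0r normrN gtr0_norm.
  rewrite -normrN opprB; apply: h2; rewrite /= sub0r normrN gtr0_norm //.
Qed.

Variables (g dg : Cx R -> Cx R) (r0 delta : R).
Hypothesis r0_gt0 : 0 < r0.
Hypothesis gD : forall z, cabs z < r0 -> forall e : R, 0 < e ->
  exists2 d : R, 0 < d & forall h, cabs h < d -> cabs (g (z + h) - g z - h * dg z) <= e * cabs h.
Hypothesis dgC : forall z, cabs z < r0 -> forall e : R, 0 < e ->
  exists2 d : R, 0 < d & forall z', cabs z' < r0 -> cabs (z' - z) < d -> cabs (dg z' - dg z) <= e.
Hypothesis g_le : forall z, cabs z < r0 -> cabs (g z) <= delta.

(** The corners of the square of half side r0/2 have modulus r0/sqrt 2, so the closed square lies in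
    the open disc; as a product of segments it is compact. *)
Let rho := r0 / 2.
Let rho_gt0 : 0 < rho. Proof. by rewrite divr_gt0. Qed.

Let in_square (z : Cx R) := `|complex.Re z| <= rho /\ `|complex.Im z| <= rho.

Let square_lt z : in_square z -> cabs z < r0.
Proof.
move=> [a b]; rewrite /cabs normc_def /= -(ltr_pXn2r (n := 2)) ?nnegrE ?sqrtr_ge0 ?ltW //.
rewrite sqr_sqrtr ?addr_ge0 ?sqr_ge0 // -(real_normK (num_real (complex.Re z))).
rewrite -(real_normK (num_real (complex.Im z))).
have h1 : `|complex.Re z| ^+ 2 <= rho ^+ 2 by rewrite ler_pXn2r ?nnegrE // ltW.
have h2 : `|complex.Im z| ^+ 2 <= rho ^+ 2 by rewrite ler_pXn2r ?nnegrE // ltW.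
have h3 : rho ^+ 2 = r0 ^+ 2 / 4 by rewrite /rho; field.
have h4 : 0 < r0 ^+ 2 by rewrite exprn_gt0.
lra.
Qed.

(** Heine-Cantor by the near-covering form of compactness: continuity of [dg] at a point yields a
    ball and a range of [d] that serves all points of the ball. *)
Let unif_cont (e : R) : 0 < e -> exists2 d : R, 0 < d & forall p q : Cx R,
  in_square p -> cabs (q - p) < d -> cabs q < r0 /\ cabs (dg q - dg p) <= e.
Proof.
move=> e0.
have /compact_near_coveringP cK : compact (`[- rho, rho]%classic `*` `[- rho, rho]%classic : set (R * R)).
  by apply: compact_setX; exact: segment_compact.
pose P (d : R) (x : R * R) := forall q : Cx R, cabs (q - (x.1 +i* x.2)) < d ->
  cabs q < r0 /\ cabs (dg q - dg (x.1 +i* x.2)) <= e.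
suff [d /= d0 hd] : \forall d \near (0 : R)^'+, `[- rho, rho]%classic `*` `[- rho, rho]%classic `<=` P d.
  exists (d / 2); first by rewrite divr_gt0.
  move=> [a b] q [/= ha hb] hq; apply: (hd (d / 2) _ _ (a, b)) => //=.
  - by rewrite sub0r normrN gtr0_norm ?divr_gt0 // gtr_pMr // invf_lt1 // ltr1n.
  - by rewrite divr_gt0.
  - by split; rewrite /= in_itv /= -ler_norml.
apply: cK.
 move=> [a b] [/=]; rewrite !in_itv /= -!ler_norml => ha hb.
  pose p : Cx R := a +i* b.
  have pr : cabs p < r0 by exact: square_lt.
  have [d0 d00 hd0] := dgC pr (divr_gt0 e0 (ltr0Sn _ 1)).
  pose m := Num.min d0 (r0 - cabs p).
  have m0 : 0 < m by rewrite lt_min d00 subr_gt0.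
  have md : m <= d0 by rewrite ge_min lexx.
  have mr : m <= r0 - cabs p by rewrite ge_min lexx orbT.
  have m4 : 0 < m / 4 by rewrite divr_gt0.
  exists (ball (a, b) (m / 4), [set d : R | d < m / 2]) => /=.
    split; first exact: nbhsx_ballx.
    by apply: nbhs_right_lt; rewrite divr_gt0.
  move=> [[a' b'] d] /= [[/= h1 h2] dm] q hq.
  move: h1 h2; rewrite /ball /= => h1 h2.
  have hp' : cabs ((a' +i* b') - p) < m / 2.
    apply: (le_lt_trans (cabs_le_ReIm _)) => /=.
    rewrite (distrC a') (distrC b'); lra.
  have hqp : cabs (q - p) < m.
    rewrite (_ : q - p = (q - (a' +i* b')) + ((a' +i* b') - p)); last by ring.
    by apply: (le_lt_trans (ler_cabsD _ _)); lra.
  have hqr : cabs q < r0.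
    rewrite -[q](subrK p); apply: (le_lt_trans (ler_cabsD _ _)); lra.
  have hpr : cabs (a' +i* b' : Cx R) < r0.
    rewrite -[X in cabs X](subrK p); apply: (le_lt_trans (ler_cabsD _ _)); lra.
  split => //.
  rewrite (_ : _ - _ = (dg q - dg p) - (dg (a' +i* b') - dg p)); last by ring.
  apply: (le_trans (ler_cabsB _ _)); rewrite [leRHS]splitr lerD //; apply: hd0 => //; lra.
Qed.

(** Mean value bound for g(p + x h) - x h dg(p) on [0, 1], whose derivative is h (dg(p + x h) -
    dg(p)). *)
Let g_incr (e : R) (p h : Cx R) :
  (forall x : R, 0 <= x <= 1 -> cabs (p + x%:C * h) < r0 /\ cabs (dg (p + x%:C * h) - dg p) <= e) ->
  cabs (g (p + h) - g p - h * dg p) <= e * cabs h.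
Proof.
move=> H.
pose f (x : R) : Cx R := g (p + x%:C * h) - x%:C * (h * dg p).
have /= := @mean_value_bound R f (fun x => h * (dg (p + x%:C * h) - dg p)) (e * cabs h) 0 1 ler01.
rewrite subr0 mulr1 /f !rmorph0 rmorph1 !mul0r !mul1r subr0 addr0 addrAC; apply.
move=> x /H[xr xe]; split; last by rewrite cabsM mulrC ler_wpM2r ?cabs_ge0.
have [h0|h0] := eqVneq h 0.
  have := has_deriv_cst (g p) x; rewrite h0 [0 * (_ - _)]mul0r; congr (has_deriv _ _ _).
  by apply/funext => y; rewrite !(mulr0, mul0r) addr0 subr0.
have hg := cabs_gt0 h0.
apply: has_deriv_eps => b b0.
have [d d0 hd] := gD xr (divr_gt0 b0 hg).
exists (d / cabs h); first by rewrite divr_gt0.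
move=> k hk; have := hd (k%:C * h); rewrite cabsM cabsR -ltr_pdivlMr // => /(_ hk).
rewrite [X in _ <= X -> _](_ : _ = b * `|k|); last by field; rewrite gt_eqF.
apply: le_trans; rewrite le_eqVlt; apply/orP; left; apply/eqP; congr cabs.
by rewrite /f rmorphD /= mulrDl addrA; ring.
Qed.

Section RootAverage.
Variables (n : nat) (zeta : Cx R) (d e : R).
Hypotheses (zetan : zeta ^+ n = 1) (zeta1 : zeta != 1) (zetaN : cabs zeta = 1).
Hypothesis d_gt0 : 0 < d.
Hypothesis zetad : cabs (zeta - 1) < d / rho.
Hypothesis dgU : forall p q : Cx R,
  in_square p -> cabs (q - p) < d -> cabs q < r0 /\ cabs (dg q - dg p) <= e.

(** A(x)/(n x) is the discrete form of the contour integral of g(z)/z^2 over the circle of radius x,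
    divided by 2 pi i. It should be almost independent of x and tend to dg(0) as x tends to 0. *)
Let A (x : R) : Cx R := \sum_(k < n) zeta ^- k * g (x%:C * zeta ^+ k).
Let dA (x : R) : Cx R := \sum_(k < n) dg (x%:C * zeta ^+ k).

Let zeta0 : zeta != 0.
Proof. by apply/eqP => z0; move: zetaN; rewrite z0 cabs0 => /esym/eqP; rewrite oner_eq0. Qed.

Let zetaX k : cabs (zeta ^+ k) = 1.
Proof. by elim: k => [|k IH]; rewrite ?expr0 ?cabs1 // exprS cabsM IH zetaN mulr1. Qed.

Let zetaVX k : cabs (zeta ^- k) = 1.
Proof. by rewrite cabsV zetaX invr1. Qed.

Let circle_square x k : 0 <= x <= rho -> in_square (x%:C * zeta ^+ k).
Proof.
move=> /andP[x0 xr]; have h : cabs (x%:C * zeta ^+ k) <= rho.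
  by rewrite cabsM zetaX mulr1 cabsR ger0_norm.
by split; apply: le_trans h; [exact: Re_le_cabs | exact: Im_le_cabs].
Qed.

Let A_deriv x : 0 <= x <= rho -> has_deriv A (dA x) x.
Proof.
move=> xr; apply: has_deriv_sum => k; apply: has_deriv_eps => b b0.
have [d0 d00 hd] := gD (square_lt (circle_square k xr)) b0.
exists d0 => // h hh; have := hd (h%:C * zeta ^+ k); rewrite cabsM zetaX mulr1 cabsR => /(_ hh).
apply: le_trans; rewrite -[leRHS]mul1r -(zetaVX k) -cabsM.
rewrite le_eqVlt; apply/orP; left; apply/eqP; congr cabs.
by rewrite rmorphD /= mulrDl; field; rewrite expf_neq0.
Qed.

(* The chain rule in the angle: the increments of [zeta ^- k * g (x zeta ^+ k)]
   in [k] sum up to 0 and are approximately [(zeta^-1 - 1)] times the terms of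
   [A x - x * dA x]. *)
Let A_radial x : 0 <= x <= rho -> cabs (x%:C * dA x - A x) <= e * n%:R * x.
Proof.
move=> xr; have /andP[x0 x1] := xr.
pose E k : Cx R := g (x%:C * zeta ^+ k.+1) - g (x%:C * zeta ^+ k)
  - (x%:C * zeta ^+ k * (zeta - 1)) * dg (x%:C * zeta ^+ k).
have hE k : cabs (E k) <= e * (x * cabs (zeta - 1)).
  have pE : x%:C * zeta ^+ k.+1 = x%:C * zeta ^+ k + x%:C * zeta ^+ k * (zeta - 1).
    by rewrite exprSr; ring.
  have <- : cabs (x%:C * zeta ^+ k * (zeta - 1)) = x * cabs (zeta - 1).
    by rewrite !cabsM zetaX cabsR mulr1 ger0_norm.
  rewrite /E pE; apply: g_incr => y /andP[y0 y1]; apply: dgU; first exact: circle_square.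
  rewrite addrC addKr !cabsM zetaX !cabsR mulr1 !ger0_norm //.
  apply: (@le_lt_trans _ _ (rho * cabs (zeta - 1))).
    by rewrite mulrA ler_wpM2r ?cabs_ge0 // (le_trans _ x1) // ler_piMl.
  by rewrite mulrC -ltr_pdivlMr.
have tel : \sum_(k < n) (zeta ^- k.+1 * g (x%:C * zeta ^+ k.+1)
    - zeta ^- k * g (x%:C * zeta ^+ k)) = 0.
  rewrite -(big_mkord xpredT (fun k => zeta ^- k.+1 * g (x%:C * zeta ^+ k.+1)
    - zeta ^- k * g (x%:C * zeta ^+ k))) telescope_sumr //.
  by rewrite zetan expr0 subrr.
have z1 : 0 < cabs (zeta - 1) by rewrite cabs_gt0 // subr_eq0.
have key : (1 - zeta^-1) * (x%:C * dA x - A x) = - \sum_(k < n) zeta ^- k.+1 * E k.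
  rewrite -[RHS]sub0r -[X in _ = X - _]tel -sumrB /dA /A mulr_sumr -sumrB mulr_sumr; apply: eq_bigr => k _; rewrite /E exprS; field.
  by rewrite zeta0 expf_neq0.
have E1 : cabs (1 - zeta^-1) = cabs (zeta - 1).
  rewrite -[LHS]mul1r -zetaN -cabsM; congr cabs; by field.
rewrite -(ler_pM2l z1) -{1}E1 -cabsM key cabsN.
apply: (le_trans (ler_cabs_sum _ _ _)).
rewrite (_ : cabs (zeta - 1) * _ = \sum_(k < n) e * (x * cabs (zeta - 1))); last first.
  by rewrite sumr_const card_ord -mulr_natr; ring.
by apply: ler_sum => k _; rewrite cabsM zetaVX mul1r.
Qed.

(** The three terms bound A(x)/(n x) on the outer circle, its drift between the radii [x0] and
    [rho], and its distance from [dg 0] at the small radius [x0]. *)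
Lemma cauchy_estimate_aux (b x0 : R) : 0 < x0 <= rho -> (0 < n)%N ->
  (forall k, cabs (g (x0%:C * zeta ^+ k) - g 0 - x0%:C * zeta ^+ k * dg 0) <= b * x0) ->
  cabs (dg 0) <= delta / rho + e * rho / x0 + b.
Proof.
move=> /andP[x00 x0r] n0 hb.
have nR : 0 < n%:R :> R by rewrite ltr0n.
pose B (x : R) : Cx R := (x^-1)%:C * A x.
(* [dgU] with equal points bounds the modulus of 0 by [e]. *)
have e0 : 0 <= e.
  have [_] := @dgU (0%:C * zeta ^+ 0) (0%:C * zeta ^+ 0) (circle_square 0 (introT andP (conj (lexx 0) (ltW rho_gt0)))) ltac:(by rewrite subrr cabs0).
  by rewrite subrr cabs0.
have incr : cabs (B rho - B x0) <= e * n%:R / x0 * (rho - x0).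
  apply: (@mean_value_bound R B (fun x => (x^-1)%:C * dA x - (x ^- 2)%:C * A x)) => // x /andP[x1 x2].
  have xg : 0 < x by exact: lt_le_trans x1.
  have xr : 0 <= x <= rho by rewrite x2 ltW.
  split; first by apply: has_deriv_inv; [rewrite gt_eqF | exact: A_deriv].
  rewrite (_ : _ - _ = (x ^- 2)%:C * (x%:C * dA x - A x)); last first.
    rewrite mulrBr mulrA -rmorphM /=; congr (_ %:C * _ - _); field; by rewrite gt_eqF.
  rewrite cabsM cabsR ger0_norm ?invr_ge0 ?sqr_ge0 //.
  rewrite mulrC ler_pdivrMr ?exprn_gt0 //; apply: (le_trans (A_radial xr)).
  rewrite (_ : _ * x ^+ 2 = e * n%:R * x * (x / x0)); last by field; rewrite gt_eqF.
  by rewrite ler_peMr ?mulr_ge0 ?ler0n ?(ltW xg) // ler_pdivlMr // mul1r.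
have Brho : cabs (B rho) <= n%:R * (delta / rho).
  rewrite cabsM cabsR ger0_norm ?invr_ge0 ?(ltW rho_gt0) // [rho^-1 * _]mulrC.
  rewrite ler_pdivrMr // -mulrA divfK ?gt_eqF //.
  apply: (le_trans (ler_cabs_sum _ _ _)).
  rewrite (_ : _ * _ = \sum_(k < n) delta); last by rewrite sumr_const card_ord mulr_natl.
  apply: ler_sum => k _; rewrite cabsM zetaVX mul1r; apply: g_le.
  by apply: square_lt; apply: circle_square; rewrite ltW /=.
(* The vanishing sum of the roots of unity removes the constant term [g 0] from the average. *)
have S0 : \sum_(k < n) zeta ^- k = 0 :> Cx R.
  have z10 : zeta^-1 - 1 != 0 by rewrite subr_eq0 invr_eq1.
  apply: (mulfI z10); rewrite mulr0.
  under eq_bigr do rewrite -exprVn.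
  by rewrite -subrX1 exprVn zetan invr1 subrr.
have Bx0 : cabs (B x0 - n%:R * dg 0) <= n%:R * b.
  have -> : B x0 - n%:R * dg 0 = (x0^-1)%:C *
      \sum_(k < n) zeta ^- k * (g (x0%:C * zeta ^+ k) - g 0 - x0%:C * zeta ^+ k * dg 0).
    have -> : \sum_(k < n) zeta ^- k * (g (x0%:C * zeta ^+ k) - g 0 - x0%:C * zeta ^+ k * dg 0)
      = A x0 - (\sum_(k < n) zeta ^- k) * g 0 - \sum_(k < n) x0%:C * dg 0.
      rewrite mulr_suml -!sumrB; apply: eq_bigr => k _; field; by rewrite expf_neq0.
    rewrite S0 mul0r subr0 sumr_const card_ord mulrBr; congr (_ - _).
    by rewrite -mulrnAr mulrA -rmorphM /= mulVf ?gt_eqF // mul1r mulr_natl.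
  rewrite cabsM cabsR ger0_norm ?invr_ge0 ?(ltW x00) // [x0^-1 * _]mulrC ler_pdivrMr //.
  apply: (le_trans (ler_cabs_sum _ _ _)).
  rewrite (_ : n%:R * b * x0 = \sum_(k < n) b * x0); last by rewrite sumr_const card_ord -mulrA mulr_natl.
  by apply: ler_sum => k _; rewrite cabsM zetaVX mul1r.
rewrite -(ler_pM2l nR).
have -> : n%:R * cabs (dg 0) = cabs (n%:R * dg 0).
  by rewrite cabsM; congr (_ * _); rewrite -[in RHS](rmorph_nat (@real_complex R)) cabsR ger0_norm ?ler0n.
have -> : n%:R * dg 0 = B rho - (B rho - B x0) - (B x0 - n%:R * dg 0) by ring.
apply: (le_trans (ler_cabsB _ _)); rewrite mulrDr; apply: lerD => //.
apply: (le_trans (ler_cabsB _ _)); rewrite mulrDr; apply: lerD => //.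
apply: (le_trans incr).
rewrite [leRHS](_ : _ = e * n%:R / x0 * rho); last by field; rewrite gt_eqF.
by rewrite ler_wpM2l ?divr_ge0 ?mulr_ge0 ?ler0n ?(ltW x00) // lerBlDr lerDl ltW.
Qed.

End RootAverage.

(** The main term is delta/rho with rho = r0/2. The order of choices matters: differentiability at 0
    gives [x0], then uniform continuity is used with accuracy b x0/(2 rho), which makes the drift
    b/2, and only then the root of unity is chosen close to 1. *)
Lemma cauchy_estimate : cabs (dg 0) <= 2 * delta / r0.
Proof.
have r00 : cabs (0 : Cx R) < r0 by rewrite cabs0.
have d0 : 0 <= delta by exact: le_trans (cabs_ge0 _) (g_le r00).
apply/ler_addgt0Pr => b b0.
have [d1 d10 hd1] := gD r00 (divr_gt0 b0 (ltr0Sn _ 1)).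
pose x0 := Num.min (d1 / 2) rho.
have x00 : 0 < x0 by rewrite lt_min divr_gt0.
have x0d : x0 < d1 by rewrite gt_min gtr_pMr // invf_lt1 // ltr1n.
have x0r : x0 <= rho by rewrite ge_min lexx orbT.
have [d dg0 hd] := unif_cont (divr_gt0 (mulr_gt0 b0 x00) (mulr_gt0 (ltr0Sn _ 1) rho_gt0)).
have [n [zeta [n0 zn z1 zN zd]]] := root_of_unity_near1 (divr_gt0 dg0 rho_gt0).
have := @cauchy_estimate_aux n zeta d _ zn z1 zN dg0 zd hd (b / 2) x0.
rewrite x00 x0r => /(_ isT n0) h; apply: (le_trans (h _)) => [k|].
  have := hd1 (x0%:C * zeta ^+ k).
  rewrite add0r cabsM cabsR gtr0_norm // (_ : cabs (zeta ^+ k) = 1).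
    by rewrite mulr1; apply.
  by elim: k => [|k IH]; rewrite ?expr0 ?cabs1 // exprS cabsM IH zN mulr1.
rewrite le_eqVlt; apply/orP; left; apply/eqP; rewrite /rho; field.
by rewrite !gt_eqF.
Qed.

End CauchyEstimate.

(** * Differentiation along a flow with unbounded frequencies *)

Section FlowDerivative.
Variable R : realType.
Implicit Types (y th om lam : int -> R).

(** A truncated frequency vector is bounded, hence a tangent vector along which [Psi] can be
    differentiated. *)
Definition trunc (N : nat) om : int -> R := fun i => if (`|i| <= N)%N then om i else 0.

Variable a : (int -> R) -> Cx R.
Hypothesis a_cont : forall kappa : R, 0 < kappa -> exists (N : nat) (d : R), 0 < d /\
  forall y y', (forall i : int, (`|i| <= N)%N -> `|y' i - y i| <= d) ->
    cabs (a y' - a y) <= kappa.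

Let window_bound om (N : nat) : exists2 M : R, 0 < M & forall i : int, (`|i| <= N)%N -> `|om i| <= M.
Proof.
exists (1 + zwin (fun i => `|om i|) N).
  by rewrite ltr_pwDl // zwin_ge0.
move=> i iN; apply: (le_trans (zwin_ge_term (F := fun i => `|om i|) _ iN)) => //.
by rewrite lerDr.
Qed.

(* [y = th + lam om], where the clock [lam i] of a coordinate far out may lag
   behind the common clock [lam 0] of the coordinates near 0: at a maximal such
   [lam] all clocks up to some [N'], depending on the point, can still be
   advanced together. *)
Lemma lagged_flow th om (G : Cx R) (eta t : R) (N : nat) (d : R) : 0 < eta -> 0 < t ->
  (forall i : int, (`|i| <= N)%N -> t * `|om i| <= d) ->
  (forall y, (forall i : int, (`|i| <= N)%N -> `|y i - th i| <= d) -> forall N1 : nat,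
     exists (N' : nat) (l : Cx R), [/\ (N1 <= N')%N, cabs (l - G) <= eta &
       forall e : R, 0 < e -> exists2 b : R, 0 < b & forall h : R, `|h| < b ->
         cabs (a (fun i => y i + h * trunc N' om i) - a y - h%:C * l) <= e * `|h|]) ->
  forall N1 : nat, (N <= N1)%N -> exists2 lam : int -> R,
    (forall i : int, (`|i| <= N1)%N -> lam i = t) &
    cabs (a (fun i => th i + lam i * om i) - a th - t%:C * G) <= 2 * eta * t.
Proof.
move=> eta0 t0 td H N1 NN1.
pose P lam := [/\ forall i, 0 <= lam i <= lam 0, lam 0 <= t,
  forall i : int, (`|i| <= N1)%N -> lam i = lam 0 &
  cabs (a (fun i => th i + lam i * om i) - a th - (lam 0)%:C * G) <= 2 * eta * lam 0].
pose T := {lam : int -> R | P lam}.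
have P0 : P (fun=> 0).
  split => //; rewrite ?lexx ?(ltW t0) // mul0r mulr0 subr0.
  rewrite (_ : (fun i => _) = th) ?subrr ?cabs0 //.
  by apply/funext => i; rewrite mul0r addr0.
pose r (l1 l2 : T) : bool := `[< forall i, sval l1 i <= sval l2 i >].
have [l0 max_l0] : exists l0 : T, forall l, r l0 l -> r l l0.
  apply: (@ZL_preorder T (exist _ _ P0) r) => [l|l1 l2 l3 /asboolP h1 /asboolP h2|A totA].
  - by apply/asboolP.
  - by apply/asboolP => i; exact: le_trans (h1 i) (h2 i).
  have [[l1 Al1]|A0] := pselect (exists l, A l); last first.
    by exists (exist _ _ P0) => l Al; exfalso; apply: A0; exists l.
  pose S i := [set sval l i | l in A].
  have S_sup i : has_sup (S i).
    split; first by exists (sval l1 i), l1.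
    exists t => _ [l _ <-]; case: (svalP l) => [h1 h2 _ _].
    by have /andP[_ h] := h1 i; exact: le_trans h h2.
  pose ls i := sup (S i).
  have ls_ub l i : A l -> sval l i <= ls i.
    by move=> Al; apply: ub_le_sup; [exact: (proj2 (S_sup i)) | exists l].
  have ls_le i c : (forall l, A l -> sval l i <= c) -> ls i <= c.
    by move=> h; apply: ge_sup; [exact: (proj1 (S_sup i)) | move=> _ [l Al <-]; exact: h].
  (* Members of a chain are comparable, so a single member comes close to the supremum at finitely
     many indices simultaneously. *)
  have approx (c : R) (s : seq int) : 0 < c ->
      exists2 l, A l & forall i, i \in s -> ls i - c < sval l i.
    move=> c0; elim: s => [|j s [l Al hl]]; first by exists l1.
    have [_ [l' Al' <-] hl'] := sup_adherent c0 (S_sup j).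
    have [/asboolP ll'|/asboolP l'l] := totA _ _ Al Al'.
    - exists l' => // i; rewrite inE => /predU1P[->//|/hl h].
      exact: lt_le_trans h (ll' i).
    - exists l => // i; rewrite inE => /predU1P[->|/hl//].
      exact: lt_le_trans hl' (l'l j).
  suff Pls : P ls.
    by exists (exist _ _ Pls) => l Al; apply/asboolP => i; exact: ls_ub.
  split.
  - move=> i; have [h _ _ _] := svalP l1; have /andP[h1 _] := h i.
    rewrite (le_trans h1) ?ls_ub //=; apply: ls_le => l Al.
    have [h' _ _ _] := svalP l; have /andP[_ h2] := h' i.
    by rewrite (le_trans h2) // ls_ub.
  - by apply: ls_le => l Al; have [] := svalP l.
  - move=> i iN1; apply/eqP; rewrite eq_le; apply/andP; split; apply: ls_le => l Al.
      by have [_ _ h _] := svalP l; rewrite h // ls_ub.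
    by have [_ _ h _] := svalP l; rewrite -(h i) // ls_ub.
  (* The estimate survives the supremum: product continuity of [a] looks at a finite window only,
     where one member of the chain has almost the same clocks. Index 0 is added to control the
     common clock. *)
  apply/ler_addgt0Pr => k k0.
  have [N3 [d3 [d30 hd3]]] := a_cont (divr_gt0 k0 (ltr0Sn _ 1)).
  have [M M0 hM] := window_bound om N3.
  have G1 : 0 < 1 + cabs G by rewrite ltr_pwDl // cabs_ge0.
  pose c := Num.min (d3 / M) (k / 2 / (1 + cabs G)).
  have c0 : 0 < c by rewrite lt_min !divr_gt0.
  have [l Al hl] := approx c (0 :: [seq j%:Z - N3%:Z | j <- iota 0 (2 * N3).+1]) c0.
  have lc i : i \in (0 :: [seq j%:Z - N3%:Z | j <- iota 0 (2 * N3).+1]) -> `|ls i - sval l i| <= c.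
    move=> /hl h; rewrite ger0_norm ?subr_ge0 ?ls_ub //; lra.
  have e1 : cabs (a (fun i => th i + ls i * om i) - a (fun i => th i + sval l i * om i)) <= k / 2.
    apply: hd3 => i iN3; rewrite opprD addrACA subrr add0r -mulrBl normrM.
    apply: (@le_trans _ _ (d3 / M * M)); last by rewrite divfK // gt_eqF.
    apply: ler_pM => //; last exact: hM.
    apply: (@le_trans _ _ c); last by rewrite ge_min lexx.
    apply: lc; rewrite inE; apply/orP; right; apply/mapP; exists `|(i + N3%:Z)%R|%N; last by lia.
    by rewrite mem_iota; lia.
  have e2 : cabs ((ls 0 - sval l 0)%:C * G) <= k / 2.
    rewrite cabsM cabsR; apply: (@le_trans _ _ (k / 2 / (1 + cabs G) * (1 + cabs G))); last first.
      by rewrite divfK // gt_eqF.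
    apply: ler_pM; rewrite ?cabs_ge0 // ?lerDr //.
    apply: (@le_trans _ _ c); last by rewrite ge_min lexx orbT.
    by apply: lc; rewrite inE eqxx.
  have [_ _ _ e3] := svalP l.
  rewrite (_ : _ - _ = (a (fun i => th i + ls i * om i) - a (fun i => th i + sval l i * om i))
    + (a (fun i => th i + sval l i * om i) - a th - (sval l 0)%:C * G)
    - (ls 0 - sval l 0)%:C * G); last by rewrite rmorphB /=; ring.
  apply: (le_trans (ler_cabsB _ _)).
  apply: (le_trans (lerD (ler_cabsD _ _) (lexx _))).
  have e4 : 2 * eta * sval l 0 <= 2 * eta * ls 0.
    by rewrite ler_wpM2l ?mulr_ge0 ?(ltW eta0) // ls_ub.
  lra.
have [h1 h2 h3 h4] := svalP l0.
have [lt_t|] := ltP (sval l0 0) t; last first.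
  move=> tl; have l0t : sval l0 0 = t by apply/eqP; rewrite eq_le h2.
  by exists (sval l0); [move=> i /h3; rewrite l0t | rewrite -l0t].
exfalso.
pose y := fun i => th i + sval l0 i * om i.
have [|N' [l [N1N' lG hl]]] := H y _ N1.
  move=> i iN; rewrite /y addrAC subrr add0r normrM.
  apply: le_trans (td i iN); rewrite ler_wpM2r //.
  by have /andP[a1 a2] := h1 i; rewrite ger0_norm // (le_trans a2).
(* The rate 2 eta consists of this linearization error and of the distance of [l] from [G], at most
   eta each. *)
have [b b0 hb] := hl eta eta0.
pose s := Num.min (b / 2) (t - sval l0 0).
have s0 : 0 < s by rewrite lt_min divr_gt0 //= subr_gt0.
have sb : s < b by rewrite gt_min gtr_pMr // invf_lt1 // ltr1n.
have st : s <= t - sval l0 0 by rewrite ge_min lexx orbT.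
pose lam i := sval l0 i + (if (`|i| <= N')%N then s else 0).
have lam0 : lam 0 = sval l0 0 + s by [].
have Plam : P lam.
  split.
  - move=> i; have /andP[a1 a2] := h1 i; rewrite lam0 /lam.
    by case: ifP => _; lra.
  - by rewrite lam0 addrC -lerBrDr.
  - by move=> i iN; rewrite lam0 /lam (leq_trans iN N1N') h3.
  - have := hb s; rewrite gtr0_norm // => /(_ sb).
    rewrite (_ : (fun i => y i + _) = (fun i => th i + lam i * om i)); last first.
      by apply/funext => i; rewrite /y /lam /trunc; case: ifP => _; ring.
    move=> e1.
    rewrite (_ : _ - _ = (a (fun i => th i + lam i * om i) - a y - s%:C * l)
      + (a y - a th - (sval l0 0)%:C * G) + s%:C * (l - G)); last first.
      by rewrite lam0 rmorphD /=; ring.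
    have e2 : cabs (s%:C * (l - G)) <= s * eta.
      by rewrite cabsM cabsR gtr0_norm // ler_wpM2l // ltW.
    apply: (le_trans (ler_cabsD _ _)).
    apply: (le_trans (lerD (ler_cabsD _ _) (lexx _))).
    rewrite lam0; lra.
have le0 : r l0 (exist _ _ Plam).
  by apply/asboolP => i /=; rewrite /lam lerDl; case: ifP => // _; exact: ltW.
have /asboolP/(_ 0) := max_l0 _ le0.
by rewrite /= lam0 gerDl leNgt s0.
Qed.

(** The lagged motion has the right increment up to e/2 times the elapsed time. The true motion
    differs from it only outside a window that may be taken as large as desired, so continuity of
    [a] in the product topology closes the gap. *)
Lemma flow_derivative th om (G : Cx R) :
  (forall eta : R, 0 < eta -> exists (N : nat) (d : R), 0 < d /\
    forall y, (forall i : int, (`|i| <= N)%N -> `|y i - th i| <= d) -> forall N1 : nat,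
    exists (N' : nat) (l : Cx R), [/\ (N1 <= N')%N, cabs (l - G) <= eta &
      forall e : R, 0 < e -> exists2 b : R, 0 < b & forall h : R, `|h| < b ->
        cabs (a (fun i => y i + h * trunc N' om i) - a y - h%:C * l) <= e * `|h|]) ->
  forall e : R, 0 < e -> exists2 d : R, 0 < d & forall h : R, `|h| < d ->
    cabs (a (fun i => th i + h * om i) - a th - h%:C * G) <= e * `|h|.
Proof.
move=> H e e0; have e4 : 0 < e / 4 by rewrite divr_gt0.
have [N [d [d0 hd]]] := H _ e4.
have [M M0 hM] := window_bound om N.
exists (d / M); first by rewrite divr_gt0.
(* Negative times are reduced to positive ones by reversing the frequencies and [G], whence the
   general [om'] and [G']. *)
have key (t : R) (om' : int -> R) (G' : Cx R) : 0 < t -> t < d / M ->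
  (forall i, `|om' i| = `|om i|) ->
  (forall y, (forall i : int, (`|i| <= N)%N -> `|y i - th i| <= d) -> forall N1 : nat,
    exists (N' : nat) (l : Cx R), [/\ (N1 <= N')%N, cabs (l - G') <= e / 4 &
      forall e : R, 0 < e -> exists2 b : R, 0 < b & forall h : R, `|h| < b ->
        cabs (a (fun i => y i + h * trunc N' om' i) - a y - h%:C * l) <= e * `|h|]) ->
  cabs (a (fun i => th i + t * om' i) - a th - t%:C * G') <= e * t.
  move=> t0 td om_om' H'.
  (* The tolerance is proportional to [t], so the window on which the clocks must agree is chosen
     after [t]. *)
  have [N2 [d2 [d20 hd2]]] := a_cont (mulr_gt0 e4 t0).
  have [|lam lamt hlam] := @lagged_flow th om' G' (e / 4) t N d e4 t0 _ H' (maxn N N2) (leq_maxl _ _).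
    move=> i iN; rewrite om_om'; apply: (@le_trans _ _ (t * M)).
      by rewrite ler_wpM2l ?(ltW t0) ?hM.
    by rewrite -ler_pdivlMr // ltW.
  have e1 : cabs (a (fun i => th i + t * om' i) - a (fun i => th i + lam i * om' i)) <= e / 4 * t.
    apply: hd2 => i iN2; rewrite lamt ?subrr ?normr0 ?(ltW d20) //.
    by rewrite (leq_trans iN2) // leq_maxr.
  rewrite (_ : _ - _ = (a (fun i => th i + t * om' i) - a (fun i => th i + lam i * om' i))
    + (a (fun i => th i + lam i * om' i) - a th - t%:C * G')); last by ring.
  apply: (le_trans (ler_cabsD _ _)).
  have : 0 < e * t by rewrite mulr_gt0.
  lra.
move=> h hh; have [h0|h0|->] := ltgtP h 0.
- have E : (fun i => th i + h * om i) = (fun i => th i + (- h) * - om i).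
    by apply/funext => i; rewrite mulrNN.
  rewrite E -mulrNN -rmorphN /= ltr0_norm //; apply: key.
  + by rewrite oppr_gt0.
  + by move: hh; rewrite ltr0_norm.
  + by move=> i; rewrite normrN.
  + move=> y hy N1; have [N' [l [N1N' lG hl]]] := hd y hy N1.
    exists N', (- l); split => //; first by rewrite -opprD cabsN.
    move=> b /hl[c c0 hc]; exists c => // x hx.
    have := hc (- x); rewrite normrN => /(_ hx).
    rewrite rmorphN /= mulNr mulrN opprK (_ : (fun i => y i + - x * _) = (fun i => y i + x * trunc N' (fun i => - om i) i)) ?opprK //.
    by apply/funext => i; rewrite /trunc; case: ifP => _; ring.
- rewrite gtr0_norm //; apply: key => //; by move: hh; rewrite gtr0_norm.
- rewrite (_ : (fun i => _) = th) ?subrr ?sub0r; last first.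
    by apply/funext => i; rewrite mul0r addr0.
  by rewrite mul0r cabsN cabs0 normr0 mulr0.
Qed.

End FlowDerivative.

(** * Maps of the phase space close to the identity *)

Section PhaseCalculus.
Variables (R : realType) (alpha : R).
Implicit Types (x y : Seq R) (u v w z : Phase R) (th : int -> R).

Local Notation weight := (weight alpha).
Local Notation norm1 := (norm1 alpha).
Local Notation normP := (normP alpha).
Local Notation dom := (dom alpha).
Local Notation "u '<=P' C" := (normP u%R <= (C%R)%:E)%E (at level 70).

Section FderivBounds.
Variables (V : lmodType R[i]) (N : V -> \bar R) (F : Phase R -> V).

Lemma lee_normP (e a : R) u : 0 <= e -> (u <=P a) -> (e%:E * normP u <= (e * a)%:E)%E.
Proof. by move=> e0 ua; rewrite EFinM lee_wpmul2l. Qed.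

Lemma fderiv_bound z (A : {linear Phase R -> V}) : is_fderiv alpha N F z A ->
  exists2 M : R, 0 < M & forall u a, (u <=P a) -> (N (A u) <= (M * a)%:E)%E.
Proof.
move=> [[M hM] _]; exists (`|M| + 1); first by rewrite ltr_wpDl.
move=> u a ua; apply: (le_trans (hM u (ltoo_le ua))).
apply: le_trans (lee_normP _ ua); last by rewrite addr_ge0.
by apply: lee_wpmul2r; [exact: normP_ge0 | rewrite lee_fin (le_trans (ler_norm _)) // lerDl].
Qed.

Lemma fderiv_approx z (A : {linear Phase R -> V}) : is_fderiv alpha N F z A ->
  forall e : R, 0 < e -> exists2 d : R, 0 < d & forall u a, a < d -> (u <=P a) ->
    (N (F (z + u) - F z - A u)%R <= (e * a)%:E)%E.
Proof.
move=> [_ h] e e0; have [d d0 hd] := h e e0; exists d => // u a ad ua.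
apply: le_trans (lee_normP (ltW e0) ua); apply: hd.
by apply: le_lt_trans ua _; rewrite lte_fin.
Qed.

End FderivBounds.

Section NearIdentity.
Variables (c : Seq R) (s r : R) (Psi : Phase R -> Phase R)
  (dPsi : Phase R -> {linear Phase R -> Phase R}) (delta rho : R).
Hypothesis PsiD : forall z, dom c s r z -> is_fderiv alpha normP Psi z (dPsi z).
Hypothesis PsiC : forall z, dom c s r z -> forall e : R, 0 < e -> exists2 d : R, 0 < d &
  forall z', dom c s r z' -> (normP (z' - z)%R < d%:E)%E -> forall u, (normP u < +oo)%E ->
    (normP (dPsi z' u - dPsi z u)%R <= e%:E * normP u)%E.
Hypothesis Psi_id : forall z, dom c s r z -> (Psi z - z <=P delta).
Hypotheses (rho0 : 0 < rho) (rho_s : rho <= s) (rho_r : rho <= r).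

(** Cauchy's estimate for t |-> l(Psi(z + t u) - (z + t u)): on the disc of radius rho/d the
    argument stays within rho of the torus point, and the function is bounded by delta. *)
Lemma functional_cauchy (l : Phase R -> Cx R) th u (d : R) :
  (forall v w, l (v - w) = l v - l w) -> (forall (k : R[i]) v, l (k *: v) = k * l v) ->
  (forall v a, (v <=P a) -> cabs (l v) <= a) ->
  0 < d -> (u <=P d) ->
  cabs (l (dPsi (c, of_angle th) u - u)) <= 2 * delta / rho * d.
Proof.
move=> lB lZ lle d0 ud.
have r0 : 0 < rho / d by rewrite divr_gt0.
pose z (t : Cx R) : Phase R := (c, of_angle th) + (t : R[i]) *: u.
have zD t : cabs t < rho / d -> dom c s r (z t).
  rewrite ltr_pdivlMr // => td; apply: (@dom_near_torus _ _ _ _ _ (cabs t * d)).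
  - by rewrite mulr_ge0 ?cabs_ge0 ?ltW.
  - exact: lt_le_trans td rho_s.
  - exact: lt_le_trans td rho_r.
  - exact: normPZ.
have z0E : z 0 = (c, of_angle th) by rewrite /z scale0r addr0.
have lD v w : l (v + w) = l v + l w.
  have <- : v - (-1 : R[i]) *: w = v + w by rewrite scaleN1r opprK.
  by rewrite lB lZ mulN1r opprK.
have zS t h : z (t + h) = z t + h *: u by rewrite /z scalerDl addrA.
have alg (p q n x : Phase R) (h : R[i]) :
    l (p - (x + h *: u)) - l (q - x) - h * l (n - u) = l (p - q - h *: n).
  by rewrite !lB lD !lZ; ring.
have alg2 (p q : Phase R) : l (p - u) - l (q - u) = l (p - q).
  by rewrite !lB; ring.
have := @cauchy_estimate R (fun t => l (Psi (z t) - z t)) (fun t => l (dPsi (z t) u - u))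
  (rho / d) delta r0.
rewrite z0E invf_div mulrA [2 * delta * d / rho]mulrAC; apply.
- move=> t /zD zt e e0.
  have [b b0 hb] := fderiv_approx (PsiD zt) (divr_gt0 e0 d0).
  exists (b / d); first by rewrite divr_gt0.
  move=> h; rewrite ltr_pdivlMr // => hb'.
  have := hb (h *: u) _ hb' (normPZ h ud).
  move=> /lle; rewrite mulrCA divfK ?gt_eqF // [cabs h * e]mulrC; apply: le_trans.
  rewrite le_eqVlt; apply/orP; left; apply/eqP; congr cabs.
  by rewrite zS alg; congr (l (_ - _)); rewrite linearZZ.
- move=> t /zD zt e e0; have [b b0 hb] := PsiC zt (divr_gt0 e0 d0).
  exists (b / d); first by rewrite divr_gt0.
  move=> t' /zD zt'; rewrite ltr_pdivlMr // => htt'.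
  have zz : z t' - z t = (t' - t) *: u by rewrite /z opprD addrACA subrr add0r scalerBl.
  have := hb _ zt' _ u (ltoo_le ud).
  have h1 : (normP (z t' - z t)%R < b%:E)%E.
    by rewrite zz; apply: le_lt_trans (normPZ _ ud) _; rewrite lte_fin.
  move=> /(_ h1) h2; have : (dPsi (z t') u - dPsi (z t) u <=P e / d * d).
    by apply: le_trans h2 _; apply: lee_normP => //; rewrite divr_ge0 ?ltW.
  move=> /lle; rewrite divfK ?gt_eqF //; apply: le_trans.
  by rewrite alg2.
- by move=> t /zD /Psi_id /lle.
Qed.

(* The weighted l^1 norm is a supremum of linear functionals, so the estimate for
   scalar functions applies. *)
Lemma near_identity_fderiv th u (d : R) : 0 < d -> (u <=P d) ->
  (dPsi (c, of_angle th) u - u <=P 2 * delta / rho * d).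
Proof.
move=> d0 ud; set v := dPsi (c, of_angle th) u - u.
apply/normP_leP; split; [apply/norm1_leP => N|apply/norm_sup_leP => j]; last first.
  apply: (@functional_cauchy (fun v => v.2 j)) => // [v' a /normP_leP[_ /norm_sup_leP]]; exact.
pose k j := projT1 (cid2 (cabs_dual (v.1 j))).
have k1 j : cabs (k j) <= 1 by rewrite /k; case: cid2.
have kE j : k j * v.1 j = (cabs (v.1 j))%:C by rewrite /k; case: cid2.
pose l (v : Phase R) : Cx R := zwin (fun j => (weight j)%:C * (k j * v.1 j)) N.
have lv : l v = (zwin (fun j => cabs (v.1 j) * weight j) N)%:C.
  rewrite /l /zwin rmorph_sum /=; apply: eq_bigr => i _.
  by rewrite kE mulrC -rmorphM.
apply: (@le_trans _ _ (cabs (l v))).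
  by rewrite lv cabsR ler_norm.
apply: functional_cauchy => // [v' w|b v'|v' a /normP_leP[/norm1_leP h _]].
- by rewrite /l /zwin -sumrB; apply: eq_bigr => i _; rewrite -!mulrBr.
- rewrite /l /zwin mulr_sumr; apply: eq_bigr => i _.
  by rewrite -[(b *: v').1 _]/(b * v'.1 _); ring.
- apply: le_trans (h N); apply: (le_trans (ler_cabs_zwin _ _)); apply: ler_zwin => i.
  rewrite cabsM cabsR ger0_norm ?weight_ge0 // mulrC ler_wpM2r ?weight_ge0 //.
  by rewrite cabsM ler_piMl ?cabs_ge0.
Qed.

End NearIdentity.

(** Completeness of the phase space, with a rate: the limit is taken coordinatewise, and the Cauchy
    bound passes to it window by window. *)
Lemma normP_lim (S : nat -> Phase R) (b : nat -> R) :
  (forall e, 0 < e -> exists n, b n <= e) ->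
  (forall n m, (n <= m)%N -> (S m - S n <=P b n)) ->
  exists L : Phase R, forall n, (L - S n <=P b n).
Proof.
move=> b0 H.
have cauchy (p : Phase R -> Cx R) : (forall u v, p (u - v) = p u - p v) ->
    (forall u C, (u <=P C) -> cabs (p u) <= C) -> cvgn (fun n => p (S n)).
  move=> pB ple; apply: cvgn_Cx => e /b0[n hn]; exists n => m nm.
  by rewrite -pB; apply: le_trans hn; apply: ple; exact: H.
have c1 j : cvgn (fun n => (S n).1 j : Cx R).
  apply: (cauchy (fun z => z.1 j)) => // u C /normP_leP[]; by move=> /norm1_coord.
have c2 j : cvgn (fun n => (S n).2 j : Cx R).
  by apply: (cauchy (fun z => z.2 j)) => // u C /normP_leP[_ /norm_sup_leP].
exists (fun j => limn (fun n => (S n).1 j : Cx R), fun j => limn (fun n => (S n).2 j : Cx R)) => n.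
apply/normP_leP; split; [apply/norm1_leP => N|apply/norm_sup_leP => j]; last first.
  apply: (@limn_close _ _ _ _ n (c2 j)) => m nm.
  by have /normP_leP[_ /norm_sup_leP] := H n m nm; apply.
apply/ler_addgt0Pr => e e0.
have D0 : 0 < (2 * N).+1%:R :> R by rewrite ltr0n.
(* Weighted distances of the coordinates in the window from their limits; being finitely many, they
   are all small at a common late index. *)
pose f m (k : 'I_(2 * N).+1) := cabs (limn (fun n => (S n).1 (k%:Z - N%:Z) : Cx R)
   - (S m).1 (k%:Z - N%:Z)) * weight (k%:Z - N%:Z).
have [m nm hm] : exists2 m, (n <= m)%N & forall k, f m k <= e / (2 * N).+1%:R.
  have F : \forall m \near \oo, forall k, f m k <= e / (2 * N).+1%:R.
    apply: filter_forall => k.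
    have /cvg_cabsP := c1 (k%:Z - N%:Z).
    move=> /(_ (e / (2 * N).+1%:R / weight (k%:Z - N%:Z))).
    rewrite !divr_gt0 ?weight_gt0 // => /(_ isT); apply: filterS => m.
    by rewrite ltr_pdivlMr ?weight_gt0 // => /ltW.
  have [M _ hM] := F; exists (maxn n M); first by rewrite leq_maxl.
  by apply: hM; rewrite /= leq_maxr.
have /normP_leP[/norm1_leP h _] := H n m nm.
apply: (@le_trans _ _ (zwin (fun j => cabs ((S m - S n).1 j) * weight j) N + \sum_k f m k)).
  rewrite /zwin -big_split /=; apply: ler_sum => k _.
  rewrite /f -mulrDl ler_wpM2r ?weight_ge0 //; apply: le_trans (ler_cabsD _ _).
  rewrite le_eqVlt; apply/orP; left; apply/eqP; congr cabs.
  by rewrite /= !fctE; ring.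
rewrite lerD //; apply: (@le_trans _ _ (\sum_(k < (2 * N).+1) (e / (2 * N).+1%:R))).
  by apply: ler_sum => k _; exact: hm.
by rewrite sumr_const card_ord -[X in X <= _]mulr_natr divfK // gt_eqF.
Qed.

(** The solution is the sum of the vectors (1 - A)^n w, whose norms decrease by a factor 1/2; the
    geometric series gives the bound 2a. *)
Lemma neumann (A : {linear Phase R -> Phase R}) w (a : R) :
  (forall u d, 0 < d -> (u <=P d) -> (A u - u <=P d / 2)) -> 0 < a -> (w <=P a) ->
  exists2 b, A b = w & (b <=P 2 * a).
Proof.
move=> hA a0 wa.
pose D n := iter n (fun u => u - A u) w.
have p0 n : 0 < a / 2 ^+ n by rewrite divr_gt0 // exprn_gt0.
have hD n : (D n <=P a / 2 ^+ n).
  elim: n => [|n IH]; first by rewrite expr0 divr1.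
  rewrite /D iterS -opprB; apply: normPN.
  rewrite exprSr invfM mulrA; exact: hA.
pose fix S n := if n is m.+1 then S m + D m else 0.
have AS n : A (S n) = w - D n.
  elim: n => [|n IH]; first by rewrite linear0 subrr.
  by rewrite -[S n.+1]/(S n + D n) linearD IH -[D n.+1]/(D n - A (D n)) opprB addrA addrAC.
have SS n m : (S (n + m)%N - S n <=P 2 * (a / 2 ^+ n) - 2 * (a / 2 ^+ (n + m)%N)).
  elim: m => [|m IH]; first by rewrite addn0 !subrr normP0.
  rewrite addnS /= addrAC; have := normPD IH (hD (n + m)%N).
  suff -> : 2 * (a / 2 ^+ n) - 2 * (a / 2 ^+ (n + m)%N) + a / 2 ^+ (n + m)%N
      = 2 * (a / 2 ^+ n) - 2 * (a / 2 ^+ (n + m).+1) by [].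
  by rewrite exprS; field; rewrite !expf_neq0.
have [|n m nm|b hb] := @normP_lim S (fun n => 2 * (a / 2 ^+ n)).
- move=> e e0; exists (Num.bound (2 * a / e)).
  have h := archi_boundP (ltW (divr_gt0 (mulr_gt0 (ltr0Sn R 1) a0) e0)).
  rewrite mulrA ler_pdivrMr ?exprn_gt0 // -ler_pdivrMl //.
  rewrite mulrC; apply: (le_trans (ltW h)).
  by rewrite -natrX ler_nat ltnW // ltn_expl.
- rewrite -(subnKC nm); apply: le_trans (SS _ _) _.
  by rewrite lee_fin gerBl mulr_ge0 // ltW.
exists b; last by have := hb 0%N; rewrite expr0 divr1 subr0.
(* The vector [A b - w] equals [A (b - S n) - D n]. Its norm is at most 4 a/2^n: 3 a/2^n from the
   first term, as A - 1 halves norms, and a/2^n from the second. *)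
apply/eqP; rewrite -subr_eq0; apply/eqP; apply: (@normP_eq0 _ alpha) => e e0.
have [n hn] : exists n, 4 * (a / 2 ^+ n) <= e.
  exists (Num.bound (4 * a / e)).
  have h := archi_boundP (ltW (divr_gt0 (mulr_gt0 (ltr0Sn R 3) a0) e0)).
  rewrite mulrA ler_pdivrMr ?exprn_gt0 // -ler_pdivrMl //.
  rewrite mulrC; apply: (le_trans (ltW h)).
  by rewrite -natrX ler_nat ltnW // ltn_expl.
have h1 := hb n.
have h2 := hA _ _ (mulr_gt0 (ltr0Sn R 1) (p0 n)) h1.
have := normPB (normPD h2 h1) (hD n).
rewrite subrK linearB AS opprB addrA addrAC addrK.
by move=> /le_trans; apply; rewrite lee_fin (le_trans _ hn) //; lra.
Qed.

Section SymplecticForm.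

Lemma sympl_action u j : sympl_form u (unit_seq R j, 0) = u.2 j.
Proof.
rewrite /sympl_form (@zsum_finite _ _ `|j|%N) => [|i ij]; last first.
  by rewrite /unit_seq /= (_ : (i == j) = false) ?mulr0 ?mul0r ?subrr //; apply/eqP; lia.
rewrite (@zwin_single _ _ j) // => [|i /negPf ij].
  by rewrite /unit_seq /= eqxx mulr1 mul0r subr0.
by rewrite /unit_seq /= ij mulr0 mul0r subrr.
Qed.

Lemma sympl_angle u j : sympl_form u (0, unit_seq R j) = - u.1 j.
Proof.
rewrite /sympl_form (@zsum_finite _ _ `|j|%N) => [|i ij]; last first.
  by rewrite /unit_seq /= (_ : (i == j) = false) ?mulr0 ?mul0r ?subrr //; apply/eqP; lia.
rewrite (@zwin_single _ _ j) // => [|i /negPf ij].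
  by rewrite /unit_seq /= eqxx mulr0 mul1r sub0r.
by rewrite /unit_seq /= ij mulr0 mul0r subrr.
Qed.

Lemma sympl_along_angle y v : sympl_form (0, y) v = pairing y v.1.
Proof. by apply: eq_zsum => j; rewrite /= mulr0 subr0. Qed.

End SymplecticForm.

End PhaseCalculus.

(** * Scalar functions and the locality of the Hamiltonian *)

Section ScalarCalculus.
Variables (R : realType) (alpha : R).
Implicit Types (x y : Seq R) (u v w z : Phase R) (th : int -> R).

Local Notation weight := (weight alpha).
Local Notation norm1 := (norm1 alpha).
Local Notation normP := (normP alpha).
Local Notation dom := (dom alpha).
Local Notation "u '<=P' C" := (normP u%R <= (C%R)%:E)%E (at level 70).
Local Notation cabsE := (fun c : Cx R => (cabs c)%:E).

Variable F : Phase R -> Cx R.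

Lemma scalar_fderiv_bound z (A : {linear Phase R -> Cx R}) : is_fderiv alpha cabsE F z A ->
  exists2 M : R, 0 < M & forall u a, (u <=P a) -> cabs (A u) <= M * a.
Proof. by move=> /fderiv_bound[M M0 h]; exists M => // u a /h; rewrite lee_fin. Qed.

Lemma scalar_fderiv_approx z (A : {linear Phase R -> Cx R}) : is_fderiv alpha cabsE F z A ->
  forall e : R, 0 < e -> exists2 d : R, 0 < d & forall u a, a < d -> (u <=P a) ->
    cabs (F (z + u) - F z - A u) <= e * a.
Proof.
move=> /fderiv_approx h e /h[d d0 hd]; by exists d => // u a ad /(hd _ _ ad).
Qed.

Lemma linear_real_scale (V : lmodType R[i]) (A : {linear Phase R -> V}) (t : R[i]) u :
  A (t *: u) = t *: A u.
Proof. by rewrite linearZZ. Qed.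

Lemma linear_scaleC (A : {linear Phase R -> Cx R}) (t : R[i]) u : A (t *: u) = t * A u.
Proof. by rewrite linearZZ. Qed.

(** Increments along small positive real multiples of [u] already determine the value at [u] of a
    Frechet derivative. *)
Lemma fderiv_dir z (A : {linear Phase R -> Cx R}) u (a : R) (l : Cx R) :
  is_fderiv alpha cabsE F z A -> (u <=P a) ->
  (forall e : R, 0 < e -> exists2 d : R, 0 < d & forall t : R, 0 < t -> t < d ->
     cabs (F (z + (t%:C : R[i]) *: u) - F z - t%:C * l) <= e * t) -> A u = l.
Proof.
move=> hA ua H.
apply/eqP; rewrite -subr_eq0; apply/eqP; apply: cabs_le0 => e e0.
have a0 : 0 <= a by rewrite -lee_fin; apply: le_trans ua; exact: normP_ge0.
have a1 : 0 < a + 1 by rewrite ltr_wpDl.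
have [d1 d10 h1] := scalar_fderiv_approx hA (divr_gt0 (divr_gt0 e0 (ltr0Sn R 1)) a1).
have [d2 d20 h2] := H _ (divr_gt0 e0 (ltr0Sn R 1)).
pose t := Num.min (d1 / (a + 1)) d2 / 2.
have t0 : 0 < t by rewrite divr_gt0 // lt_min d20 divr_gt0.
have t2 : t < d2.
  by rewrite ltr_pdivrMr // gt_min mulr_natr mulr2n ltrDl d20 orbT.
have t1 : t * (a + 1) < d1.
  rewrite -ltr_pdivlMr // ltr_pdivrMr // gt_min; apply/orP; left.
  by rewrite mulr_natr mulr2n ltrDl divr_gt0.
have u1 : (u <=P a + 1) by apply: le_trans ua _; rewrite lee_fin lerDl.
have := h1 ((t%:C : R[i]) *: u) (t * (a + 1)) t1.
rewrite linear_scaleC.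
have -> : (((t%:C : R[i]) *: u) <=P t * (a + 1)).
  by have := normPZ (t%:C) u1; rewrite cabsR gtr0_norm.
move=> /(_ isT); rewrite mulrCA divfK ?gt_eqF // => h3.
have h4 := h2 t t0 t2.
rewrite -(ler_pM2l t0); have <- : cabs (t%:C * (A u - l)) = t * cabs (A u - l).
  by rewrite cabsM cabsR gtr0_norm.
move: h3 h4; move: (F (z + _)) (F z) (A u) => p q n h3 h4.
rewrite (_ : _ * _ = (p - q - t%:C * l) - (p - q - t%:C * n)); last by ring.
apply: (le_trans (ler_cabsB _ _)); lra.
Qed.

Lemma partial_action x y (A : {linear Phase R -> Cx R}) j :
  is_fderiv alpha cabsE F (x, y) A ->
  partial (fun I => F (I, y)) j x = A (unit_seq R j, 0).
Proof.
move=> hA; apply: derive1_eq => e e0.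
have w0 := weight_gt0 alpha j.
have [d d0 hd] := scalar_fderiv_approx hA (divr_gt0 e0 w0).
exists (d / weight j); first by rewrite divr_gt0.
move=> h; rewrite ltr_pdivlMr // => hw.
have := hd _ _ hw (normPZ h (normP_action (norm1_unit alpha j))).
rewrite mulrCA divfK ?gt_eqF // mulrC; apply: le_trans.
rewrite linear_scaleC add0r scale0r addr0.
rewrite (_ : (x, y) + _ = (x + h *: unit_seq R j, y)) //.
by congr (_, _); rewrite /= scaler0 addr0.
Qed.

Lemma partial_angle x y (A : {linear Phase R -> Cx R}) j :
  is_fderiv alpha cabsE F (x, y) A ->
  partial (fun y => F (x, y)) j y = A (0, unit_seq R j).
Proof.
move=> hA; apply: derive1_eq => e e0.
have [d d0 hd] := scalar_fderiv_approx hA e0.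
exists d => // h hw.
have u1 : ((0, unit_seq R j) <=P 1).
  apply/normP_angle; first exact: ler01.
  by apply/norm_sup_leP; exact: norm_sup_unit.
have := hd _ _ _ (normPZ h u1); rewrite mulr1 => /(_ hw); apply: le_trans.
rewrite linear_scaleC add0r scale0r addr0.
rewrite (_ : (x, y) + _ = (x, y + h *: unit_seq R j)) //.
by congr (_, _); rewrite /= scaler0 addr0.
Qed.

(** The chain rule read backwards: the increments of the composite are known from the normal form,
    and they determine the derivative of the outer function at the image vector. One third of [e]
    goes to these increments, one to the linearization of [F], one to that of [Psi]. *)
Lemma chain_dir (Psi : Phase R -> Phase R) z (B : {linear Phase R -> Phase R})
    (A : {linear Phase R -> Cx R}) u (a : R) (l : Cx R) :
  is_fderiv alpha normP Psi z B -> is_fderiv alpha cabsE F (Psi z) A -> (u <=P a) ->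
  (forall e : R, 0 < e -> exists2 d : R, 0 < d & forall t : R, 0 < t -> t < d ->
     cabs (F (Psi (z + (t%:C : R[i]) *: u)) - F (Psi z) - t%:C * l) <= e * t) -> A (B u) = l.
Proof.
move=> hB hA ua H.
apply/eqP; rewrite -subr_eq0; apply/eqP; apply: cabs_le0 => e e0.
have a0 : 0 <= a by rewrite -lee_fin; apply: le_trans ua; exact: normP_ge0.
have [a1 a10 ua1] : exists2 a1 : R, 0 < a1 & (u <=P a1).
  exists (a + 1); first by rewrite ltr_wpDl.
  by apply: le_trans ua _; rewrite lee_fin lerDl.
have [M M0 hM] := scalar_fderiv_bound hA.
have [K K0 hK] := fderiv_bound hB.
have C0 : 0 < (K + 1) * a1 by rewrite mulr_gt0 // ltr_wpDl // ltW.
have e3 : 0 < e / 3 by rewrite divr_gt0.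
have [d1 d10 h1] := H _ e3.
have [d2 d20 h2] := scalar_fderiv_approx hA (divr_gt0 e3 C0).
(* The bound 1 keeps the increment [v] of [Psi] below (K + 1) t a1; the other bound keeps the image
   under [A] of its linearization error below e t/3. *)
pose k := Num.min 1 (e / 3 / M / a1).
have k0 : 0 < k by rewrite lt_min ltr01 !divr_gt0.
have k1 : k <= 1 by rewrite ge_min lexx.
have kM : M * (k * a1) <= e / 3.
  have : k <= e / 3 / M / a1 by rewrite ge_min lexx orbT.
  by rewrite ler_pdivlMr // ler_pdivlMr // mulrC.
have [d3 d30 h3] := fderiv_approx hB k0.
pose t := Num.min d1 (Num.min (d2 / ((K + 1) * a1)) (d3 / a1)) / 2.
have m0 : 0 < Num.min d1 (Num.min (d2 / ((K + 1) * a1)) (d3 / a1)).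
  by rewrite !lt_min d10 !divr_gt0.
have t0 : 0 < t by rewrite divr_gt0.
have tm : t < Num.min d1 (Num.min (d2 / ((K + 1) * a1)) (d3 / a1)).
  by rewrite ltr_pdivrMr // mulr_natr mulr2n ltrDl.
move: tm; rewrite !lt_min => /and3P[t1 t2 t3].
have {}t2 : t * ((K + 1) * a1) < d2 by rewrite -ltr_pdivlMr.
have {}t3 : t * a1 < d3 by rewrite -ltr_pdivlMr.
have tu : ((t%:C : R[i]) *: u <=P t * a1).
  by have := normPZ (t%:C) ua1; rewrite cabsR gtr0_norm.
set v := Psi (z + (t%:C : R[i]) *: u) - Psi z.
have verr : (v - (t%:C : R[i]) *: B u <=P k * (t * a1)).
  by have := h3 _ _ t3 tu; rewrite linear_real_scale.
have tBu : ((t%:C : R[i]) *: B u <=P K * (t * a1)).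
  by rewrite -linear_real_scale; exact: hK.
have vle : (v <=P t * ((K + 1) * a1)).
  have := normPD verr tBu; rewrite subrK => /le_trans; apply; rewrite lee_fin.
  have : k * (t * a1) <= 1 * (t * a1) by rewrite ler_wpM2r // mulr_ge0 // ltW.
  nra.
have e1 := h1 t t0 t1.
have e2 := h2 v _ t2 vle.
have e4 := hM _ _ verr.
have Pv : Psi z + v = Psi (z + (t%:C : R[i]) *: u) by rewrite /v addrC subrK.
rewrite Pv in e2.
have Av : A (v - (t%:C : R[i]) *: B u) = A v - t%:C * A (B u).
  by rewrite linearB linear_scaleC.
rewrite Av in e4.
rewrite -(ler_pM2l t0); have <- : cabs (t%:C * (A (B u) - l)) = t * cabs (A (B u) - l).
  by rewrite cabsM cabsR gtr0_norm.
move: e1 e2 e4; move: (F (Psi (z + _))) (F (Psi z)) (A v) (A (B u)) => p q n m e1 e2 e4.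
rewrite (_ : _ * _ = (p - q - t%:C * l) - (p - q - n) - (n - t%:C * m)); last by ring.
apply: (le_trans (ler_cabsB _ _)); apply: (le_trans (lerD (ler_cabsB _ _) (lexx _))).
have e5 : e / 3 / ((K + 1) * a1) * (t * ((K + 1) * a1)) = e / 3 * t.
  by rewrite mulrCA divfK ?gt_eqF // mulrC.
rewrite e5 in e2.
have e6 : M * (k * (t * a1)) <= e / 3 * t.
  rewrite (_ : _ * _ = M * (k * a1) * t); last by ring.
  by rewrite ler_wpM2r // ltW.
lra.
Qed.

End ScalarCalculus.

(** * Nearest-neighbour coupling and continuity in the product topology *)

Section Locality.
Variables (R : realType) (alpha eps : R).
Variables (h : int -> int -> Cx R -> Cx R -> Cx R).
Variables (f : int -> int -> Cx R -> Cx R -> Cx R -> Cx R -> Cx R).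
Variable D : set (Phase R).
Implicit Types (u v w z : Phase R).
Hypothesis hD : ham_defined alpha D h f.

Local Notation normP := (normP alpha).
Local Notation "u '<=P' C" := (normP u%R <= (C%R)%:E)%E (at level 70).
Local Notation cabsE := (fun c : Cx R => (cabs c)%:E).

Lemma ham_analytic : analytic alpha D (Ham eps h f).
Proof.
have [_ [[d0 [h0 c0]] [d1 [h1 c1]]]] := hD.
pose dH z : {linear Phase R -> Cx R} := d0 z \+ (eps%:C : R[i]) \*: d1 z.
have dHE z u : dH z u = d0 z u + eps%:C * d1 z u by [].
have k0 : 0 < 1 + `|eps| by rewrite ltr_pwDl.
have kM (p q : Cx R) (a : R) : cabs p <= a -> cabs q <= a ->
    cabs (p + eps%:C * q) <= (1 + `|eps|) * a.
  move=> pa qa; apply: (le_trans (ler_cabsD _ _)).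
  by rewrite cabsM cabsR mulrDl mul1r lerD // ler_wpM2l.
exists dH; split=> z zD.
- have [[M0 hM0] a0] := h0 z zD; have [[M1 hM1] a1] := h1 z zD; split.
  + exists ((1 + `|eps|) * (`|M0| + `|M1|)) => u ufin.
    have := hM0 u ufin; have := hM1 u ufin; have [a a00 ->] := normP_fin_eq ufin.
    rewrite -!EFinM !lee_fin dHE => h2 h3; rewrite -mulrA; apply: kM.
      apply: (le_trans h3); rewrite ler_wpM2r // (le_trans (ler_norm _)) // lerDl //.
    by apply: (le_trans h2); rewrite ler_wpM2r // (le_trans (ler_norm _)) // lerDr.
  + move=> e e0; have [b0 b00 hb0] := a0 _ (divr_gt0 e0 k0).
    have [b1 b10 hb1] := a1 _ (divr_gt0 e0 k0).
    exists (Num.min b0 b1); first by rewrite lt_min b00.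
    move=> u; rewrite EFin_min lt_min => /andP[/[dup] ufin /hb0 + /hb1].
    have [a a00 ->] := normP_fin_eq (lt_trans ufin (ltry _)).
    rewrite -!EFinM !lee_fin dHE /Ham => h2 h3.
    have := kM _ _ _ h2 h3; rewrite mulrA [(1 + _) * _]mulrC divfK ?gt_eqF //.
    apply: le_trans; rewrite le_eqVlt; apply/orP; left; apply/eqP; congr cabs.
    by move: (H0 h _) (H0 h _) (H1 f _) (H1 f _) (d0 z u) (d1 z u) => ? ? ? ? ? ?; ring.
- move=> e e0; have [b0 b00 hb0] := c0 z zD _ (divr_gt0 e0 k0).
  have [b1 b10 hb1] := c1 z zD _ (divr_gt0 e0 k0).
  exists (Num.min b0 b1); first by rewrite lt_min b00.
  move=> z' z'D; rewrite EFin_min lt_min => /andP[/(hb0 _ z'D) h2 /(hb1 _ z'D) h3] u ufin.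
  have := h2 u ufin; have := h3 u ufin; have [a a00 ->] := normP_fin_eq ufin.
  rewrite -!EFinM !lee_fin !dHE => h4 h5.
  have := kM _ _ _ h5 h4; rewrite mulrA [(1 + _) * _]mulrC divfK ?gt_eqF //.
  apply: le_trans; rewrite le_eqVlt; apply/orP; left; apply/eqP; congr cabs.
  by move: (d0 z' u) (d0 z u) (d1 z' u) (d1 z u) => ? ? ? ?; ring.
Qed.

Definition supported_at (j : int) v := forall i : int, i != j -> v.1 i = 0 /\ v.2 i = 0.

(** Radius 2: moving the coordinate [j] changes site terms at distance at most 1, and these read
    coordinates one step further away. *)
Definition agree_near (j : int) z z' :=
  forall i : int, (`|i - j| <= 2)%N -> z.1 i = z'.1 i /\ z.2 i = z'.2 i.

Lemma site_local j z z' v : supported_at j v -> agree_near j z z' -> forall i,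
  site0 h (z + v).1 i - site0 h z.1 i = site0 h (z' + v).1 i - site0 h z'.1 i /\
  site1 f (z + v) i - site1 f z i = site1 f (z' + v) i - site1 f z' i.
Proof.
move=> vj zz' i.
have ag l : (`|l - j| <= 2)%N -> [/\ z.1 l = z'.1 l, z.2 l = z'.2 l,
    (z + v).1 l = (z' + v).1 l & (z + v).2 l = (z' + v).2 l].
  by move=> /zz'[e1 e2]; split => //; rewrite /= !fctE ?e1 ?e2.
have nv z0 l : l != j -> (z0 + v).1 l = z0.1 l /\ (z0 + v).2 l = z0.2 l.
  by move=> /vj[e1 e2]; rewrite /= !fctE e1 e2 !addr0.
(* Either [i] is within 1 of [j], and all coordinates read agree at [z] and [z'], or neither [i] nor
   [l] is [j], and the increment vanishes at both points. *)
have key l : l \in neighbours i ->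
  [/\ (z + v).1 l = (z' + v).1 l, (z + v).1 i = (z' + v).1 i, z.1 l = z'.1 l, z.1 i = z'.1 i &
      [/\ (z + v).2 l = (z' + v).2 l, (z + v).2 i = (z' + v).2 i, z.2 l = z'.2 l & z.2 i = z'.2 i]]
  \/ forall z0, [/\ (z0 + v).1 l = z0.1 l, (z0 + v).1 i = z0.1 i, (z0 + v).2 l = z0.2 l
      & (z0 + v).2 i = z0.2 i].
  rewrite !inE => hl.
  have [ij|ij] := boolP (`|i - j| <= 1)%N.
    left; have [|a1 a2 a3 a4] := ag l; first by case/or3P: hl => /eqP ->; lia.
    by have [|b1 b2 b3 b4] := ag i; first lia.
  right => z0; have [|] := nv z0 l; first by case/or3P: hl => /eqP ->; apply/eqP; lia.
  by have [|] := nv z0 i; first by apply/eqP; lia.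
split.
- rewrite /site0 -!sumrB; apply: eq_big_seq => l /key[[-> -> -> -> _]//|hz].
  by have [-> -> _ _] := hz z; have [-> -> _ _] := hz z'; rewrite !subrr.
- rewrite /site1 /f_at -!sumrB; apply: eq_big_seq => l /key[[-> -> -> -> [-> -> -> ->]]//|hz].
  by have [-> -> -> ->] := hz z; have [-> -> -> ->] := hz z'; rewrite !subrr.
Qed.

(** The points may differ at infinitely many sites, so the energies themselves are not comparable;
    their increments are, term by term in the convergent series. *)
Lemma ham_local j z z' v : D z -> D z' -> D (z + v) -> D (z' + v) ->
  supported_at j v -> agree_near j z z' ->
  Ham eps h f (z + v) - Ham eps h f z = Ham eps h f (z' + v) - Ham eps h f z'.
Proof.
have [cv _] := hD => /cv[c1 c2] /cv[c3 c4] /cv[c5 c6] /cv[c7 c8] vj zz'.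
have loc := site_local vj zz'.
have e0 : H0 h (z + v).1 - H0 h z.1 = H0 h (z' + v).1 - H0 h z'.1.
  exact: (eq_zsumB c5 c1 c7 c3 (fun i => proj1 (loc i))).
have e1 : H1 f (z + v) - H1 f z = H1 f (z' + v) - H1 f z'.
  exact: (eq_zsumB c6 c2 c8 c4 (fun i => proj2 (loc i))).
rewrite /Ham; move: e0 e1.
move: (H0 h _) (H0 h _) (H0 h _) (H0 h _) (H1 f _) (H1 f _) (H1 f _) (H1 f _).
move=> a1 a2 a3 a4 b1 b2 b3 b4 e0 e1.
apply: (@eq_trans _ _ ((a4 - a3) + eps%:C * (b4 - b3))); first by ring.
by rewrite e0 e1; ring.
Qed.

Variable dH : Phase R -> {linear Phase R -> Cx R}.
Hypothesis dH_fderiv : forall z, D z -> is_fderiv alpha cabsE (Ham eps h f) z (dH z).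
Hypothesis dH_cont : forall z, D z -> forall e : R, 0 < e -> exists2 d : R, 0 < d &
  forall z', D z' -> (normP (z' - z)%R < d%:E)%E -> forall u, (normP u < +oo)%E ->
    ((cabs (dH z' u - dH z u))%:E <= e%:E * normP u)%E.
Hypothesis D_open : forall z, D z -> exists2 d : R, 0 < d & forall v, (v <=P d) -> D (z + v).

Lemma ham_deriv_local j z z' w (C : R) : D z -> D z' -> agree_near j z z' ->
  supported_at j w -> (w <=P C) -> dH z w = dH z' w.
Proof.
move=> zD z'D zz' wj wC; apply: (fderiv_dir (dH_fderiv zD) wC) => e e0.
have C0 : 0 <= C by rewrite -lee_fin; apply: le_trans wC; exact: normP_ge0.
have C1 : 0 < C + 1 by rewrite ltr_wpDl.
have wC1 : (w <=P C + 1) by apply: le_trans wC _; rewrite lee_fin lerDl.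
have [d1 d10 hd1] := scalar_fderiv_approx (dH_fderiv z'D) (divr_gt0 e0 C1).
have [d2 d20 hd2] := D_open zD; have [d3 d30 hd3] := D_open z'D.
exists (Num.min d1 (Num.min d2 d3) / (C + 1)); first by rewrite divr_gt0 // !lt_min d10 d20.
move=> t t0; rewrite ltr_pdivlMr // !lt_min => /and3P[t1 t2 t3].
have tw : ((t%:C : R[i]) *: w <=P t * (C + 1)).
  by have := normPZ (t%:C) wC1; rewrite cabsR gtr0_norm.
have := hd1 _ _ t1 tw; rewrite linear_scaleC mulrCA divfK ?gt_eqF // [t * e]mulrC.
rewrite (@ham_local j z' z) //; last 4 first.
- by apply: hd3; apply: le_trans tw _; rewrite lee_fin ltW.
- by apply: hd2; apply: le_trans tw _; rewrite lee_fin ltW.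
- by move=> i /wj[w1 w2]; rewrite /= !fctE w1 w2; split; exact: mulr0.
- by move=> i /zz'[-> ->].
Qed.

(** The point [z'] need not be close to [z] in norm. It is replaced by [z + v], where [v] copies
    [z' - z] on the five sites around [j]: locality leaves the derivative along [w] unchanged, and
    [v] is small in norm. *)
Lemma ham_deriv_product_cont j z w (C : R) : D z -> supported_at j w -> (w <=P C) ->
  forall e : R, 0 < e -> exists2 d : R, 0 < d & forall z', D z' ->
    (forall i : int, (`|i - j| <= 2)%N -> cabs (z'.1 i - z.1 i) <= d /\ cabs (z'.2 i - z.2 i) <= d) ->
    cabs (dH z' w - dH z w) <= e.
Proof.
move=> zD wj wC e e0.
have C0 : 0 <= C by rewrite -lee_fin; apply: le_trans wC; exact: normP_ge0.
have C1 : 0 < C + 1 by rewrite ltr_wpDl.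
have wC1 : (w <=P C + 1) by apply: le_trans wC _; rewrite lee_fin lerDl.
have [d1 d10 hd1] := dH_cont zD (divr_gt0 e0 C1).
have [d2 d20 hd2] := D_open zD.
(* Dominates the total weight of the five sites, and so converts a coordinatewise bound into a bound
   on [normP]. *)
pose W := 1 + zwin (weight alpha) (`|j| + 2)%N.
have W0 : 0 < W by rewrite ltr_pwDl // zwin_ge0 // => i; exact: weight_ge0.
pose d := Num.min d1 d2 / 2 / W.
have d0 : 0 < d by rewrite !divr_gt0 // lt_min d10.
exists d => // z' z'D hz.
pose v : Phase R := (fun i => if (`|(i - j)%R| <= 2)%N then z'.1 i - z.1 i else 0,
  fun i => if (`|(i - j)%R| <= 2)%N then z'.2 i - z.2 i else 0).
have vd : (v <=P d * W).
  apply/normP_leP; split; [apply/norm1_leP => N|apply/norm_sup_leP => i] => /=; last first.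
    case: ifP => [/hz[_ h2]|_].
      by rewrite (le_trans h2) // ler_peMr ?(ltW d0) // lerDl zwin_ge0 // => k; exact: weight_ge0.
    by rewrite cabs0 mulr_ge0 // ltW.
  set g := (fun i : int => _).
  have g0 i : 0 <= g i by rewrite mulr_ge0 ?cabs_ge0 ?weight_ge0.
  apply: (@le_trans _ _ (zwin g (maxn N (`|j| + 2)))).
    by apply: zwin_homo => //; rewrite leq_maxl.
  rewrite (@zwin_stable _ _ (`|j| + 2)%N) ?leq_maxr //; last first.
    by move=> i ij; rewrite /g ifF ?cabs0 ?mul0r //; apply/negP; lia.
  apply: (@le_trans _ _ (d * zwin (weight alpha) (`|j| + 2)%N)); last first.
    by rewrite ler_wpM2l ?(ltW d0) // lerDr.
  rewrite -zwinZ; apply: ler_zwin => i; rewrite /g; case: ifP => [/hz[h1 _]|_].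
    by rewrite ler_wpM2r ?weight_ge0.
  by rewrite cabs0 mul0r mulr_ge0 ?weight_ge0 ?(ltW d0).
have dW : d * W = Num.min d1 d2 / 2 by rewrite divfK // gt_eqF.
have m0 : 0 < Num.min d1 d2 by rewrite lt_min d10.
have dW1 : d * W < d1.
  by rewrite dW ltr_pdivrMr // gt_min; apply/orP; left; rewrite mulr_natr mulr2n ltrDl.
have dW2 : d * W <= d2.
  by rewrite dW ler_pdivrMr // ge_min; apply/orP; right; rewrite mulr_natr mulr2n lerDl ltW.
have zvD : D (z + v) by apply: hd2; apply: le_trans vd _; rewrite lee_fin.
rewrite (@ham_deriv_local j z' (z + v) w C) //; last first.
  by move=> i ij; rewrite /v /= !fctE ij; split; ring.
have := hd1 _ zvD; rewrite addrC addKr.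
have h1 : (normP v < d1%:E)%E by apply: le_lt_trans vd _; rewrite lte_fin.
move=> /(_ h1 w (ltoo_le wC)) h2; rewrite -lee_fin; apply: le_trans h2 _.
apply: le_trans (lee_normP _ wC1) _; first by rewrite ltW // divr_gt0.
by rewrite divfK // gt_eqF.
Qed.

End Locality.

(** * The normal form *)

Section NormalForm.
Variables (R : realType) (alpha : R).
Implicit Types (x y : Seq R) (u v w z b : Phase R) (th : int -> R).

Local Notation normP := (normP alpha).
Local Notation dom := (dom alpha).
Local Notation "u '<=P' C" := (normP u%R <= (C%R)%:E)%E (at level 70).
Local Notation cabsE := (fun c : Cx R => (cabs c)%:E).

Variables (I0 : Seq R) (s r : R) (F P : Phase R -> Cx R) (e0 : Cx R).
Variables (om : int -> R) (Omega : {linear Seq R -> Seq R}).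
Hypotheses (s_gt0 : 0 < s) (r_gt0 : 0 < r).
Hypothesis P_analytic : analytic alpha (dom 0 s r) P.
Hypothesis P_order : order_ge 3 (dom 0 s r) P.
Hypothesis F_normal : forall I theta, dom I0 s r (I, theta) ->
  F (I, theta) = e0 + pairing (of_angle om) (I - I0)
    + 2^-1 * pairing (Omega (I - I0)) (I - I0) + P (I - I0, theta).

Lemma remainder0 y : dom 0 s r (0, y) -> P (0, y) = 0.
Proof.
by move=> zD; have := @P_order _ zD 0%N isT; rewrite /= scale0r.
Qed.

(** In angle directions, complex ones included, [P] is constantly 0 at zero action; in action
    directions its derivative is the Taylor term of degree 1. *)
Lemma remainder_fderiv th (A : {linear Phase R -> Cx R}) b (a : R) :
  is_fderiv alpha cabsE P (0, of_angle th) A -> (b <=P a) -> A b = 0.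
Proof.
move=> hA ba.
have z0D : dom 0 s r (0, of_angle th) by exact: dom_torus.
have [a1 a10 ba1] : exists2 a1 : R, 0 < a1 & (b <=P a1).
  by apply: normP_fin; exact: ltoo_le ba.
have [d d0 hd] := dom_open z0D.
have /normP_leP[b1 b2] := ba1.
have b2P : ((0, b.2) <=P a1).
  by apply/normP_angle; [exact: ltW | apply/norm_sup_leP].
have b1P : ((b.1, 0) <=P a1) by exact: normP_action.
have -> : b = (b.1, 0) + (0, b.2).
  by case: (b) => p q /=; congr (_, _); rewrite /= ?addr0 ?add0r.
rewrite linearD [X in _ + X](_ : _ = 0) ?addr0; last first.
  apply: (fderiv_dir hA b2P) => e e_gt0; exists (d / a1); first by rewrite divr_gt0.
  move=> t t0; rewrite ltr_pdivlMr // => td.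
  have tb : ((t%:C : R[i]) *: (0, b.2) <=P t * a1).
    by have := normPZ (t%:C) b2P; rewrite cabsR gtr0_norm.
  have : dom 0 s r ((0, of_angle th) + (t%:C : R[i]) *: (0, b.2)).
    by apply: hd; apply: le_trans tb _; rewrite lee_fin ltW.
  rewrite (_ : _ + _ = (0, of_angle th + (t%:C : R[i]) *: b.2)); last first.
    by congr (_, _); rewrite /= scaler0 addr0.
  by move=> /remainder0 ->; rewrite remainder0 // mulr0 !subr0 cabs0 mulr_ge0 // ltW.
(* [order_ge] speaks of points of the domain only, so the action direction is first scaled into
   it. *)
pose k := d / 2 / a1.
have k0 : 0 < k by rewrite !divr_gt0.
have kb : ((k%:C : R[i]) *: (b.1, 0) <=P d).
  have := normPZ (k%:C) b1P; rewrite cabsR gtr0_norm // /k divfK ?gt_eqF //.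
  by move=> /le_trans; apply; rewrite lee_fin; lra.
have := @P_order _ (hd _ kb) 1%N isT.
rewrite (_ : _ + _ = ((k%:C : R[i]) *: b.1, of_angle th)); last first.
  by congr (_, _); rewrite /= ?add0r ?scaler0 ?addr0.
rewrite /= (_ : derive1 _ 0 = A ((k%:C : R[i]) *: (b.1, 0))).
  rewrite linear_scaleC => /eqP; rewrite mulf_eq0 => /orP[|/eqP //].
  by rewrite fmorph_eq0 gt_eqF.
apply: derive1_eq => e e_gt0.
have [d1 d10 hd1] := scalar_fderiv_approx hA (divr_gt0 e_gt0 d0).
exists (d1 / d); first by rewrite divr_gt0.
move=> h; rewrite ltr_pdivlMr // => hh.
have := hd1 _ _ hh (normPZ h kb); rewrite linear_scaleC [e / d * _]mulrCA divfK ?gt_eqF // [cabs h * e]mulrC.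
rewrite add0r scale0r (_ : (0, _) + _ = (h *: ((k%:C : R[i]) *: b.1), of_angle th)) //.
by congr (_, _); rewrite /= ?add0r ?scaler0 ?addr0.
Qed.

Lemma normal_form_torus th : F (I0, of_angle th) = e0.
Proof.
rewrite F_normal; last exact: dom_torus.
rewrite subrr remainder0; last exact: dom_torus.
by rewrite /pairing !zsum0 ?mulr0 ?addr0 // => i; rewrite mulr0.
Qed.

(** The quadratic term and [P] are both o(t). The parameter [t] is complex, so that the estimate
    yields the complex partial derivatives as well as real increments. *)
Lemma normal_form_dir th b (a : R) : (b <=P a) -> forall e : R, 0 < e ->
  exists2 d : R, 0 < d & forall t : R[i], cabs t < d ->
    cabs (F ((I0, of_angle th) + t *: b) - F (I0, of_angle th)
          - t * pairing (of_angle om) b.1) <= e * cabs t.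
Proof.
move=> ba e e_gt0.
have [a1 a10 ba1] : exists2 a1 : R, 0 < a1 & (b <=P a1).
  by apply: normP_fin; exact: ltoo_le ba.
have zD : dom I0 s r (I0, of_angle th) by exact: dom_torus.
have z0D : dom 0 s r (0, of_angle th) by exact: dom_torus.
have [d1 d10 hd1] := dom_open zD.
have [dP [hP _]] := P_analytic.
have PA := hP _ z0D.
have e2 : 0 < e / 2 by rewrite divr_gt0.
have [d2 d20 hd2] := scalar_fderiv_approx PA (divr_gt0 e2 a10).
pose K := pairing (Omega b.1) b.1.
have K0 : 0 < cabs K + 1 by rewrite ltr_wpDl // cabs_ge0.
pose d := Num.min (d1 / a1) (Num.min (d2 / a1) (e / (cabs K + 1))).
exists d; first by rewrite !lt_min !divr_gt0.
move=> t; rewrite !lt_min => /and3P[].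
rewrite ltr_pdivlMr // => t1; rewrite ltr_pdivlMr // => t2; rewrite ltr_pdivlMr // => t3.
have tb := normPZ t ba1.
have zt : dom I0 s r (I0 + t *: b.1, of_angle th + t *: b.2).
  by apply: (hd1 (t *: b)); apply: le_trans tb _; rewrite lee_fin ltW.
have -> : (I0, of_angle th) + t *: b = (I0 + t *: b.1, of_angle th + t *: b.2) by [].
rewrite normal_form_torus (F_normal zt).
have -> : I0 + t *: b.1 - I0 = t *: b.1 by rewrite addrAC subrr add0r.
(* [zsumZ] covers divergent series too, so the homogeneity of both pairings in [t] holds whatever
   [Omega] is. *)
have -> : pairing (of_angle om) (t *: b.1) = t * pairing (of_angle om) b.1.
  by rewrite /pairing -zsumZ; apply: eq_zsum => i; exact: mulrCA.
have -> : pairing (Omega (t *: b.1)) (t *: b.1) = t * t * K.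
  rewrite /K /pairing -zsumZ; apply: eq_zsum => i; rewrite linearZZ.
  exact: mulrACA.
have := hd2 _ _ t2 tb.
rewrite (remainder_fderiv PA tb) remainder0 // !subr0.
rewrite (_ : (0, of_angle th) + t *: b = (t *: b.1, of_angle th + t *: b.2)); last first.
  by congr (_, _); rewrite /= add0r.
move: (P _) (pairing _ _) => p q hp.
rewrite (_ : _ - _ = 2^-1 * (t * t * K) + p); last by ring.
apply: (le_trans (ler_cabsD _ _)).
rewrite !cabsM cabsV.
have -> : cabs (2 : R[i]) = 2.
  by rewrite -(rmorph_nat (@real_complex R)) cabsR ger0_norm.
have ea : e / 2 / a1 * (cabs t * a1) = e / 2 * cabs t.
  by rewrite mulrCA divfK ?gt_eqF // mulrC.
rewrite ea in hp.
have h4 : cabs t * cabs K <= e.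
  apply: le_trans (ltW t3); rewrite ler_wpM2l ?cabs_ge0 // lerDl //.
have h5 : cabs t * (cabs t * cabs K) <= cabs t * e by rewrite ler_wpM2l ?cabs_ge0.
lra.
Qed.

End NormalForm.

(** * The transformed torus *)

Section TorusPoint.
Variable R : realType.
Implicit Types (th om : int -> R).

Definition torus_point (I0 : Seq R) th : Phase R := (I0, of_angle th).

Lemma torus_pointD I0 th om (h : R) :
  torus_point I0 (fun i => th i + h * om i)
    = torus_point I0 th + (h%:C : R[i]) *: (0, of_angle om).
Proof.
congr (_, _) => /=; first by rewrite scaler0 addr0.
by apply/funext => i; rewrite /of_angle /= rmorphD rmorphM /= !fctE.
Qed.

Lemma flat_torusE I0 : flat_torus I0 = range (torus_point I0).
Proof.
apply/seteqP; split=> [[x y] [/= -> [th ->]]|_ [th _ <-]]; first by exists th.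
by split => //; exists th.
Qed.

Lemma torus_point_period I0 th k : torus_point I0 (th + period R k) = tshift k (torus_point I0 th).
Proof.
by congr (_, _); apply/funext => i; rewrite /of_angle /= !fctE rmorphD.
Qed.

End TorusPoint.

Section TransformedTorus.
Variables (R : realType) (alpha : R).
Implicit Types (x y : Seq R) (u v w z b : Phase R) (th om phi : int -> R).

Local Notation weight := (weight alpha).
Local Notation normP := (normP alpha).
Local Notation dom := (dom alpha).
Local Notation "u '<=P' C" := (normP u%R <= (C%R)%:E)%E (at level 70).
Local Notation cabsE := (fun c : Cx R => (cabs c)%:E).

Lemma angle_le phi (C : R) : 0 <= C -> (forall i, `|phi i| <= C) -> ((0, of_angle phi) <=P C).
Proof. by move=> C0 h; apply/normP_angle => // j; rewrite /of_angle cabsR. Qed.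

Variables (I0 : Seq R) (s r : R) (Psi : Phase R -> Phase R)
  (dPsi : Phase R -> {linear Phase R -> Phase R}) (delta : R).
Hypotheses (alpha_gt0 : 0 < alpha) (s_gt0 : 0 < s) (r_gt0 : 0 < r).
Local Notation D' := (dom I0 s r).
Hypothesis PsiD : forall z, D' z -> is_fderiv alpha normP Psi z (dPsi z).
Hypothesis Psi_id : forall z, D' z -> (Psi z - z <=P delta).
Hypothesis dPsi_id : forall th u (d : R), 0 < d -> (u <=P d) ->
  (dPsi (torus_point I0 th) u - u <=P d / 2).
Hypothesis Psi_equiv : equivariant_on D' Psi.
Hypothesis Psi_sympl : symplectic_on alpha D' Psi.

Local Notation K := (fun th => Psi (torus_point I0 th)).

Let torusD th : D' (torus_point I0 th). Proof. exact: dom_torus. Qed.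

Let shift_ext th om (x h : R) : (fun i => th i + (x + h) * om i)
  = (fun i => (fun i => th i + x * om i) i + h * om i).
Proof. by apply/funext => i; rewrite mulrDl addrA. Qed.

(** The direction must be bounded to be a tangent vector; for the frequencies this applies to their
    truncations. *)
Lemma embedding_dir (q : Phase R -> Cx R) th phi (C : R) :
  (forall u v, q (u - v) = q u - q v) -> (forall (t : R[i]) u, q (t *: u) = t * q u) ->
  (forall u a, (u <=P a) -> cabs (q u) <= a) -> ((0, of_angle phi) <=P C) ->
  forall e : R, 0 < e -> exists2 d : R, 0 < d & forall h : R, `|h| < d ->
    cabs (q (K (fun i => th i + h * phi i)) - q (K th)
      - h%:C * q (dPsi (torus_point I0 th) (0, of_angle phi))) <= e * `|h|.
Proof.
move=> qB qZ qle phiC e e0.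
have [C1 C10 phiC1] : exists2 C1 : R, 0 < C1 & ((0, of_angle phi) <=P C1).
  by apply: normP_fin; exact: ltoo_le phiC.
have [d d0 hd] := fderiv_approx (PsiD (torusD th)) (divr_gt0 e0 C10).
exists (d / C1); first by rewrite divr_gt0.
move=> h; rewrite ltr_pdivlMr // => hh.
have hphi : ((h%:C : R[i]) *: (0, of_angle phi) <=P `|h| * C1).
  by have := normPZ (h%:C) phiC1; rewrite cabsR.
have := qle _ _ (hd _ _ hh hphi).
rewrite linear_real_scale mulrCA divfK ?gt_eqF // [_ * e]mulrC torus_pointD.
by rewrite 2!qB qZ.
Qed.

(* [th' - th] is bounded a priori by [eta + 2 delta], because [Psi] is close to the
   identity; only then does the contraction estimate for [Psi - id] apply. *)
Lemma embedding_close th th' (eta : R) : 0 <= eta ->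
  (forall j, cabs ((K th').2 j - (K th).2 j) <= eta) ->
  forall j, `|th' j - th j| <= 2 * eta.
Proof.
move=> eta0 H; pose phi j := th' j - th j.
have phiE : th' = (fun i => th i + 1 * phi i).
  by apply/funext => i; rewrite mul1r /phi addrC subrK.
have bnd j : `|phi j| <= eta + 2 * `|delta|.
  have E : (phi j)%:C = ((K th').2 j - (K th).2 j)
     - ((Psi (torus_point I0 th') - torus_point I0 th').2 j
     - (Psi (torus_point I0 th) - torus_point I0 th).2 j).
    by rewrite /= !fctE /of_angle /phi rmorphB /=; ring.
  have hd th0 : cabs ((Psi (torus_point I0 th0) - torus_point I0 th0).2 j) <= `|delta|.
    have /normP_leP[_ /norm_sup_leP h] := Psi_id (torusD th0).
    exact: le_trans (h j) (ler_norm _).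
  rewrite -cabsR E; apply: (le_trans (ler_cabsB _ _)); rewrite lerD //.
  by apply: (le_trans (ler_cabsB _ _)); rewrite mulr_natl mulr2n lerD.
(* The mean value inequality for [Psi - id] along the segment improves a bound C to eta + C/2; at
   the supremum S this reads S <= eta + S/2. *)
have half (C : R) : 0 < C -> (forall j, `|phi j| <= C) -> forall j, `|phi j| <= eta + C / 2.
  move=> C0 hC j; have phiC := angle_le (ltW C0) hC.
  pose q (z : Phase R) : Cx R := z.2 j.
  pose f (x : R) : Cx R := q (K (fun i => th i + x * phi i)) - x%:C * (phi j)%:C.
  pose df (x : R) : Cx R :=
    q (dPsi (torus_point I0 (fun i => th i + x * phi i)) (0, of_angle phi) - (0, of_angle phi)).
  have := @mean_value_bound R f df (C / 2) 0 1 ler01.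
  rewrite subr0 mulr1 => mv.
  have {mv} : cabs (f 1 - f 0) <= C / 2.
    apply: mv => x _; split; last first.
      have /normP_leP[_ /norm_sup_leP] := dPsi_id (fun i => th i + x * phi i) C0 phiC.
      exact.
    apply: has_deriv_eps => e e0.
    have [|||d d0 hd] := @embedding_dir q (fun i => th i + x * phi i) phi C _ _ _ phiC e e0 => //.
      by move=> u a /normP_leP[_ /norm_sup_leP]; exact.
    exists d => // h /hd; rewrite -shift_ext; apply: le_trans.
    rewrite le_eqVlt; apply/orP; left; apply/eqP; congr cabs.
    have -> : df x = q (dPsi (torus_point I0 (fun i => th i + x * phi i)) (0, of_angle phi))
      - (phi j)%:C by [].
    by rewrite /f rmorphD /=; ring.
  rewrite /f -phiE (_ : (fun i => th i + 0 * phi i) = th); last first.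
    by apply/funext => i; rewrite mul0r addr0.
  rewrite rmorph0 rmorph1 mul0r mul1r subr0 => h.
  rewrite -cabsR (_ : (phi j)%:C = (q (K th') - q (K th)) - (q (K th') - (phi j)%:C - q (K th))); last by ring.
  by apply: (le_trans (ler_cabsB _ _)); rewrite lerD // /q; exact: H.
have S_sup : has_sup (range (fun j => `|phi j|)).
  by split; [exists `|phi 0|, 0 | exists (eta + 2 * `|delta|) => _ [j _ <-]].
pose S := sup (range (fun j => `|phi j|)).
have phiS j : `|phi j| <= S by apply: ub_le_sup; [exact: (proj2 S_sup) | exists j].
suff S2 : S <= 2 * eta by move=> j; exact: le_trans (phiS j) S2.
apply/ler_addgt0Pr => e e0.
have Se : 0 < S + e by rewrite ltr_wpDl // (le_trans _ (phiS 0)).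
have : S <= eta + (S + e) / 2.
  apply: ge_sup; first exact: (proj1 S_sup).
  move=> _ [j _ <-]; apply: half => // i; apply: le_trans (phiS i) _.
  by rewrite lerDl ltW.
lra.
Qed.

Lemma embedding_injective : injective K.
Proof.
move=> th th' E; apply/funext => j; apply/eqP; rewrite eq_sym -subr_eq0 -normr_le0.
rewrite -[0](mulr0 2); apply: embedding_close => // i.
by rewrite E subrr cabs0.
Qed.

Lemma embedding_cont th (e : R) : 0 < e ->
  (exists2 d : R, 0 < d & forall th',
     (norm_sup (of_angle (th' - th)%R) < d%:E)%E -> (normP (K th' - K th)%R < e%:E)%E) /\
  (exists2 d : R, 0 < d & forall th',
     (normP (K th' - K th)%R < d%:E)%E -> (norm_sup (of_angle (th' - th)%R) < e%:E)%E).
Proof.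
move=> e0; split.
- have [M M0 hM] := fderiv_bound (PsiD (torusD th)).
  have [d d0 hd] := fderiv_approx (PsiD (torusD th)) ltr01.
  exists (Num.min d (e / (1 + M))); first by rewrite lt_min d0 divr_gt0 // addr_gt0.
  move=> th'; have := norm_sup_ge0 (of_angle (th' - th)).
  case E : (norm_sup _) => [a| |] //; rewrite lee_fin lte_fin lt_min => a0 /andP[ad].
  rewrite ltr_pdivlMr ?addr_gt0 // => ae.
  have ua : ((0, of_angle (th' - th)) <=P a).
    by apply/normP_angle => //; apply/norm_sup_leP; rewrite E.
  have := normPD (hd _ _ ad ua) (hM _ _ ua); rewrite subrK.
  have -> : torus_point I0 th + (0, of_angle (th' - th)) = torus_point I0 th'.
    congr (_, _) => /=; first by rewrite addr0.
    by apply/funext => i; rewrite /of_angle /= !fctE rmorphB /=; ring.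
  by move=> /le_lt_trans; apply; rewrite lte_fin -mulrDl mulrC.
- exists (e / 4); first by rewrite divr_gt0.
  move=> th' /ltW /normP_leP[_ /norm_sup_leP h].
  apply: (@le_lt_trans _ _ (e / 2)%:E); last by rewrite lte_fin; lra.
  apply/norm_sup_leP => j; rewrite /of_angle cabsR.
  rewrite (_ : e / 2 = 2 * (e / 4)); last by field.
  by apply: embedding_close => //; rewrite ltW // divr_gt0.
Qed.

Section Coordinate.
(** Covers both coordinates at site [j]: the angle [u.2 j], with [w] the action basis vector, and
    the opposite [- u.1 j] of the action, with [w] the angle basis vector. *)
Variables (w : Phase R) (W : R) (j : int) (q : Phase R -> Cx R).
Hypotheses (W_gt0 : 0 < W) (wW : (w <=P W)) (qE : forall u, sympl_form u w = q u).
Hypothesis qB : forall u v, q (u - v) = q u - q v.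
Hypothesis qZ : forall (t : R[i]) u, q (t *: u) = t * q u.
Hypothesis q_le : forall u a, (u <=P a) -> cabs (q u) <= a.
Hypothesis q_tshift : forall k z, k j = 0 -> q (tshift k z) = q z.

Lemma sympl_preimage th : exists b, [/\ (b <=P 2 * W), dPsi (torus_point I0 th) b = w &
  forall phi C, ((0, of_angle phi) <=P C) ->
    q (dPsi (torus_point I0 th) (0, of_angle phi)) = pairing (of_angle phi) b.1].
Proof.
have [b bw bW] := neumann (@dPsi_id th) W_gt0 wW.
exists b; split => // phi C phiC.
rewrite -qE -bw -sympl_along_angle.
apply: (Psi_sympl (torusD th) (PsiD (torusD th))).
  exact: ltoo_le phiC.
exact: ltoo_le bW.
Qed.

(** Duality between growth of order [weight] and [norm1]; it serves for displacements of the angles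
    and for the unbounded frequencies. *)
Lemma pairing_le phi b (k C : R) : 0 <= k -> (forall i, `|phi i| <= k * weight i) -> (b <=P C) ->
  forall N, zwin (fun i => cabs (of_angle phi i * b.1 i)) N <= k * C.
Proof.
move=> k0 hphi /normP_leP[/norm1_leP hb _] N.
apply: (@le_trans _ _ (k * zwin (fun i => cabs (b.1 i) * weight i) N)); last by rewrite ler_wpM2l.
rewrite -zwinZ; apply: ler_zwin => i; rewrite cabsM cabsR mulrCA.
by rewrite mulrC ler_wpM2l ?cabs_ge0.
Qed.

(** The constant 2 W is the bound on the preimage of [w]. Boundedness of [phi] enters qualitatively,
    to differentiate along the segment: [C] is absent from the result. *)
Lemma coordinate_lipschitz th phi (k C : R) : 0 <= k -> (forall i, `|phi i| <= k * weight i) ->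
  ((0, of_angle phi) <=P C) ->
  cabs (q (K (fun i => th i + phi i)) - q (K th)) <= 2 * W * k.
Proof.
move=> k0 hphi phiC.
have := @mean_value_bound R (fun x : R => q (K (fun i => th i + x * phi i)))
  (fun x : R => q (dPsi (torus_point I0 (fun i => th i + x * phi i)) (0, of_angle phi)))
  (2 * W * k) 0 1 ler01.
rewrite subr0 mulr1 (_ : (fun i => th i + 1 * phi i) = (fun i => th i + phi i)); last first.
  by apply/funext => i; rewrite mul1r.
rewrite (_ : (fun i => th i + 0 * phi i) = th); last first.
  by apply/funext => i; rewrite mul0r addr0.
apply => x _; split.
  apply: has_deriv_eps => e e0.
  have [d d0 hd] := embedding_dir (fun i => th i + x * phi i) qB qZ q_le phiC e0.
  by exists d => // h /hd; rewrite -shift_ext.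
have [b [bW _ bE]] := sympl_preimage (fun i => th i + x * phi i).
rewrite (bE _ _ phiC).
by rewrite mulrC; apply: zsum_le; exact: pairing_le bW.
Qed.

(* Far coordinates are moved by less than [2 pi] after a shift by a period, and
   moving coordinate [i] by [phi i] changes [q] by [O(phi i / weight i)]. *)
Lemma coordinate_cont (kappa : R) : 0 < kappa -> exists (N : nat) (d : R), 0 < d /\
  forall th th', (forall i : int, (`|i| <= N)%N -> `|th' i - th i| <= d) ->
    cabs (q (K th') - q (K th)) <= kappa.
Proof.
move=> k0; pose k := kappa / (2 * W).
have kk0 : 0 < k by rewrite divr_gt0 // mulr_gt0.
have pi0 := pi_gt0 R.
have pi20 : 0 < 2 * pi :> R by rewrite mulr_gt0.
(* Beyond [N] one has 2 pi <= k |i| <= k [weight i], and [j] itself is within [N], so that the shift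
   by periods leaves [q] unchanged. The Lipschitz constant 2 W dictates [k]. *)
pose N := maxn `|j| (Num.bound (2 * pi / k)).
exists N, k; split => // th th' H.
pose m i : int := if (`|i| <= N)%N then 0 else - Num.floor ((th' i - th i) / (2 * pi)).
pose phi i := th' i + period R m i - th i.
have hphi i : `|phi i| <= if (`|i| <= N)%N then k else 2 * pi.
  rewrite /phi /period /m; case: ifP => iN; first by rewrite mulr0 addr0 H.
  have /andP[] := floor_itv ((th' i - th i) / (2 * pi)).
  rewrite ler_pdivlMr // ltr_pdivrMr // rmorphN rmorphD /= rmorph1.
  move: ((Num.floor _)%:~R : R) => c h1 h2.
  rewrite ler_norml; apply/andP; split; nra.
have hw i : `|phi i| <= k * weight i.
  apply: (le_trans (hphi i)); case: ifP => [_|iN].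
    by rewrite ler_peMr ?(ltW kk0) // weight_ge1.
  rewrite -ler_pdivrMl // mulrC.
  apply: le_trans (weight_ge_abs i alpha_gt0).
  apply: (le_trans (ltW (archi_boundP (ltW (divr_gt0 pi20 kk0))))).
  rewrite ler_nat; apply: leq_trans (leq_maxr `|j| _) _.
  by rewrite -/N ltnW // ltnNge iN.
have phiC : ((0, of_angle phi) <=P k + 2 * pi).
  apply: angle_le; first by rewrite addr_ge0 // ltW.
  by move=> i; apply: (le_trans (hphi i)); case: ifP => _; rewrite ?lerDl ?lerDr ltW.
have := coordinate_lipschitz th (ltW kk0) hw phiC.
have -> : (fun i => th i + phi i) = th' + period R m.
  by apply/funext => i; rewrite /phi !fctE; ring.
rewrite torus_point_period Psi_equiv // q_tshift.
  by rewrite /k mulrC divfK // gt_eqF // mulr_gt0.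
by rewrite /m leq_maxl.
Qed.

End Coordinate.

Lemma sup_coordinate (j : int) u a : (u <=P a) -> cabs (u.2 j) <= a.
Proof. by move=> /normP_leP[_ /norm_sup_leP]; exact. Qed.

Lemma action_coordinate (j : int) u a : (u <=P a) -> cabs (- u.1 j) <= a.
Proof. by rewrite cabsN => /normP_leP[/norm1_coord]. Qed.

Lemma unit_action_le j : ((unit_seq R j, 0) <=P weight j).
Proof. by apply: normP_action; exact: norm1_unit. Qed.

Lemma unit_angle_le j : ((0, unit_seq R j) <=P 1).
Proof.
by apply/normP_angle; [exact: ler01 | apply/norm_sup_leP; exact: norm_sup_unit].
Qed.

Lemma embedding_coord_cont i (kappa : R) : 0 < kappa -> exists (N : nat) (d : R), 0 < d /\
  forall th th', (forall i : int, (`|i| <= N)%N -> `|th' i - th i| <= d) ->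
    cabs ((K th').1 i - (K th).1 i) <= kappa /\ cabs ((K th').2 i - (K th).2 i) <= kappa.
Proof.
move=> k0.
have [|||||||N2 [d2 [d20 h2]]] := @coordinate_cont (unit_seq R i, 0) (weight i) i (fun u => u.2 i)
  _ _ _ _ _ _ _ kappa k0.
- exact: weight_gt0.
- exact: unit_action_le.
- by move=> u; exact: sympl_action.
- by [].
- by [].
- exact: sup_coordinate.
- move=> k z ki; rewrite /tshift /= !fctE /of_angle /period ki mulr0z mulr0.
  exact: addr0.
have [|||||||N1 [d1 [d10 h1]]] := @coordinate_cont (0, unit_seq R i) 1 i (fun u => - u.1 i)
  _ _ _ _ _ _ _ kappa k0.
- exact: ltr01.
- exact: unit_angle_le.
- by move=> u; exact: sympl_angle.
- by move=> u v; exact: opprD.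
- by move=> t u; rewrite -mulrN.
- exact: action_coordinate.
- by [].
exists (maxn N1 N2), (Num.min d1 d2); split; first by rewrite lt_min d10.
move=> th th' H; split.
- rewrite -cabsN opprD; apply: h1 => l lN; apply: (@le_trans _ _ (Num.min d1 d2)).
    by apply: H; rewrite leq_max lN.
  by rewrite ge_min lexx.
- apply: h2 => l lN; apply: (@le_trans _ _ (Num.min d1 d2)).
    by apply: H; rewrite leq_max lN orbT.
  by rewrite ge_min lexx orbT.
Qed.

Lemma embedding_coords_cont (l : seq int) (kappa : R) : 0 < kappa -> exists (N : nat) (d : R), 0 < d /\
  forall th th', (forall i : int, (`|i| <= N)%N -> `|th' i - th i| <= d) -> forall i, i \in l ->
    cabs ((K th').1 i - (K th).1 i) <= kappa /\ cabs ((K th').2 i - (K th).2 i) <= kappa.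
Proof.
move=> k0; elim: l => [|i l [N1 [d1 [d10 h1]]]]; first by exists 0%N, 1.
have [N2 [d2 [d20 h2]]] := embedding_coord_cont i k0.
exists (maxn N1 N2), (Num.min d1 d2); split; first by rewrite lt_min d10.
move=> th th' H k; rewrite inE => /predU1P[->|kl].
- apply: h2 => m mN; apply: (@le_trans _ _ (Num.min d1 d2)).
    by apply: H; rewrite leq_max mN orbT.
  by rewrite ge_min lexx orbT.
- apply: h1 => // m mN; apply: (@le_trans _ _ (Num.min d1 d2)).
    by apply: H; rewrite leq_max mN.
  by rewrite ge_min lexx.
Qed.

Section Flow.
Variables (s1 r1 eps : R) (om : int -> R) (M : R).
Variables (h : int -> int -> Cx R -> Cx R -> Cx R)
  (f : int -> int -> Cx R -> Cx R -> Cx R -> Cx R -> Cx R)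
  (dH : Phase R -> {linear Phase R -> Cx R}).
Local Notation D := (dom I0 s1 r1).
Local Notation H := (Ham eps h f).
Hypothesis hD : ham_defined alpha D h f.
Hypothesis Psi_dom : forall z, D' z -> D (Psi z).
Hypothesis dH_fderiv : forall z, D z -> is_fderiv alpha cabsE H z (dH z).
Hypothesis dH_cont : forall z, D z -> forall e : R, 0 < e -> exists2 d : R, 0 < d &
  forall z', D z' -> (normP (z' - z)%R < d%:E)%E -> forall u, (normP u < +oo)%E ->
    ((cabs (dH z' u - dH z u))%:E <= e%:E * normP u)%E.
Hypotheses (M_gt0 : 0 < M) (om_le : forall i, `|om i| <= M * weight i).
Hypothesis normal_form : forall th b a, (b <=P a) -> forall e : R, 0 < e ->
  exists2 d : R, 0 < d & forall t : R[i], cabs t < d ->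
    cabs (H (Psi (torus_point I0 th + t *: b)) - H (Psi (torus_point I0 th))
          - t * pairing (of_angle om) b.1) <= e * cabs t.

(** Half of [eta] pays for replacing [dH] at the nearby point by [dH] at [K th], the other half for
    truncating the pairing. *)
Lemma coordinate_flow w W j q : 0 < W -> (w <=P W) -> (forall u, sympl_form u w = q u) ->
  (forall u v, q (u - v) = q u - q v) -> (forall (t : R[i]) u, q (t *: u) = t * q u) ->
  (forall u a, (u <=P a) -> cabs (q u) <= a) ->
  (forall k z, k j = 0 -> q (tshift k z) = q z) -> supported_at j w ->
  forall th (e : R), 0 < e -> exists2 d : R, 0 < d & forall t : R, `|t| < d ->
    cabs (q (K (fun i => th i + t * om i)) - q (K th) - t%:C * dH (K th) w) <= e * `|t|.
Proof.
move=> W0 wW qE qB qZ qle qs wj th.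
apply: (@flow_derivative R (fun th => q (K th)) (coordinate_cont W0 wW qE qB qZ qle qs) th om).
move=> eta eta0; have eta2 : 0 < eta / 2 by rewrite divr_gt0.
have KD th0 : D (K th0) by apply: Psi_dom; exact: torusD.
have D_open z : D z -> exists2 d : R, 0 < d & forall v, (v <=P d) -> D (z + v).
  exact: dom_open.
have [d1 d10 hd1] := ham_deriv_product_cont hD dH_fderiv dH_cont D_open (KD th) wj wW eta2.
have [N [d [d0 hd]]] := embedding_coords_cont [:: j - 2; j - 1; j; j + 1; j + 2] d10.
exists N, d; split => // y hy N1.
have [b [bW bw bE]] := sympl_preimage W0 wW qE y.
have dHb : dH (K y) w = pairing (of_angle om) b.1.
  rewrite -bw; apply: (chain_dir (PsiD (torusD y)) (dH_fderiv (KD y)) bW) => e e0.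
  have [c c0 hc] := normal_form y bW e0; exists c => // t t0 tc.
  by have := hc (t%:C); rewrite cabsR gtr0_norm //; exact.
(* The cut-off depends on [y] through [b]. *)
have [N2 hN2] := zsum_tail (pairing_le (ltW M_gt0) om_le bW) eta2.
pose N' := maxn N1 N2.
exists N', (pairing (of_angle (trunc N' om)) b.1); split; first by rewrite leq_maxl.
- have h1 : cabs (dH (K y) w - dH (K th) w) <= eta / 2.
    apply: hd1; first exact: KD.
    move=> i ij; apply: hd => //; rewrite !inE.
    have : i = j - 2 \/ i = j - 1 \/ i = j \/ i = j + 1 \/ i = j + 2 by lia.
    by move=> [->|[->|[->|[->|->]]]]; rewrite eqxx ?orbT.
  have h2 := hN2 N' (leq_maxr _ _).
  have -> : pairing (of_angle (trunc N' om)) b.1 = zwin (fun i => of_angle om i * b.1 i) N'.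
    rewrite /pairing (@zsum_finite _ _ N') => [|i iN]; last first.
      by rewrite /of_angle /trunc leqNgt iN /= mul0r.
    by apply: eq_zwin => i iN; rewrite /of_angle /trunc iN.
  rewrite dHb /pairing in h1; move: h1 h2; move: (zsum _) (zwin _ _) (dH _ _) => a1 a2 a3 h1 h2.
  rewrite (_ : a2 - a3 = (a1 - a3) - (a1 - a2)); last by ring.
  by apply: (le_trans (ler_cabsB _ _)); rewrite [leRHS]splitr lerD.
- pose C := zwin (fun i => `|om i|) N'.
  have truncC : ((0, of_angle (trunc N' om)) <=P C).
    have C0 : 0 <= C by apply: zwin_ge0.
    apply: angle_le => // i; rewrite /trunc; case: ifP => [iN|_]; last by rewrite normr0.
    exact: (zwin_ge_term (F := fun i => `|om i|)).
  by rewrite -(bE _ _ truncC) => e e0; exact: embedding_dir truncC e e0.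
Qed.

Lemma embedding_ham_solution th : ham_solution H (fun t => K (fun j => th j + t * om j)).
Proof.
move=> t j; pose th_t := fun j => th j + t * om j.
have HD : is_fderiv alpha cabsE H ((K th_t).1, (K th_t).2) (dH (K th_t)).
  by rewrite -surjective_pairing; apply: dH_fderiv; apply: Psi_dom; exact: torusD.
have unit0 (i l : int) : i != l -> unit_seq R l i = 0.
  by move=> /negPf il; rewrite /unit_seq il.
split.
- rewrite (partial_action j HD); apply: has_deriv_eps => e e0.
  have [||||||||d d0 hd] := @coordinate_flow (unit_seq R j, 0) (weight j) j (fun u => u.2 j)
    _ _ _ _ _ _ _ _ th_t e e0.
  + exact: weight_gt0.
  + exact: unit_action_le.
  + by move=> u; exact: sympl_action.
  + by [].
  + by [].
  + exact: sup_coordinate.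
  + move=> k z ki; rewrite /tshift /= !fctE /of_angle /period ki mulr0z mulr0.
    exact: addr0.
  + by move=> i /unit0 ij; split.
  by exists d => // x /hd; rewrite -shift_ext.
(* Pairing with the angle basis vector gives minus the action, whose derivative is plus the angle
   partial of [H]; this accounts for the sign in the second equation. *)
- rewrite (partial_angle j HD); apply: has_deriv_eps => e e0.
  have [||||||||d d0 hd] := @coordinate_flow (0, unit_seq R j) 1 j (fun u => - u.1 j)
    _ _ _ _ _ _ _ _ th_t e e0.
  + exact: ltr01.
  + exact: unit_angle_le.
  + by move=> u; exact: sympl_angle.
  + by move=> u v; exact: opprD.
  + by move=> x u; rewrite -mulrN.
  + exact: action_coordinate.
  + by [].
  + by move=> i /unit0 ij; split.
  exists d => // x /hd; rewrite -shift_ext; apply: le_trans.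
  rewrite -cabsN le_eqVlt; apply/orP; left; apply/eqP; congr cabs.
  by move: (dH _ _) ((K _).1 j) ((K _).1 j) => a1 a2 a3; ring.
Qed.

Lemma embedding_kam_torus : kam_torus alpha D H om (Psi @` flat_torus I0).
Proof.
exists K; split.
- split; first by rewrite flat_torusE image_comp.
  by rewrite flat_torusE => _ [_ [th _ <-] <-]; apply: Psi_dom; exact: torusD.
- exact: embedding_injective.
- by move=> k th; rewrite torus_point_period Psi_equiv.
- by move=> th e e0; exact: embedding_cont.
- exact: embedding_ham_solution.
Qed.

End Flow.

End TransformedTorus.

(** * The flat torus and the conclusion *)

Section FlatTorus.
Variables (R : realType) (alpha : R).
Implicit Types (th om : int -> R).

Local Notation normP := (normP alpha).
Local Notation dom := (dom alpha).
Local Notation "u '<=P' C" := (normP u%R <= (C%R)%:E)%E (at level 70).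

Lemma pairing_unit (x : Seq R) j : pairing x (unit_seq R j) = x j.
Proof.
have F0 i : i != j -> x i * unit_seq R j i = 0 by move=> /negPf ij; rewrite /unit_seq ij mulr0.
rewrite /pairing (@zsum_finite _ _ `|j|%N) => [|i ij]; last first.
  by apply: F0; apply/eqP; lia.
by rewrite (zwin_single F0) // /unit_seq eqxx mulr1.
Qed.

(** The normal form has action partials [om j] and zero angle partials on the torus. The motion is
    exactly affine in each coordinate, so unbounded frequencies cause no difficulty here. *)
Lemma flat_kam_torus (I0 : Seq R) (s r : R) (F : Phase R -> Cx R) om : 0 < s -> 0 < r ->
  (forall th b a, (b <=P a) -> forall e : R, 0 < e ->
    exists2 d : R, 0 < d & forall t : R[i], cabs t < d ->
      cabs (F (torus_point I0 th + t *: b) - F (torus_point I0 th)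
            - t * pairing (of_angle om) b.1) <= e * cabs t) ->
  kam_torus alpha (dom I0 s r) F om (flat_torus I0).
Proof.
move=> s0 r0 NF; exists (torus_point I0); split.
- by rewrite flat_torusE; split => // _ [th _ <-]; exact: dom_torus.
- move=> th th' [E]; apply/funext => j; have := congr1 (fun x => x j) E.
  by rewrite /of_angle => /(congr1 (@complex.Re R)).
- by move=> k th; exact: torus_point_period.
- move=> th e e0.
  have E th' : normP (torus_point I0 th' - torus_point I0 th) = norm_sup (of_angle (th' - th)).
    rewrite (_ : _ - _ = (0, of_angle (th' - th))); last first.
      congr (_, _) => /=; first by rewrite subrr.
      by apply/funext => i; rewrite /of_angle /= !fctE rmorphB.
    rewrite /Defs.normP /= norm1_0; apply/max_idPr; exact: norm_sup_ge0.
  by split; exists e => // th'; rewrite E.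
- move=> th t j; split; apply: has_deriv_eps => e e0.
  + have -> : partial (fun I => F (I, of_angle (fun j => th j + t * om j))) j I0 = (om j)%:C.
      apply: derive1_eq => b b0.
      have [d d0 hd] := NF (fun j => th j + t * om j) _ _ (unit_action_le alpha j) _ b0.
      exists d => // h /hd; rewrite /= pairing_unit add0r scale0r addr0.
      rewrite /torus_point (_ : (I0, _) + h *: _ =
        (I0 + h *: unit_seq R j, of_angle (fun j => th j + t * om j))) //.
      by congr (_, _); rewrite /= scaler0 addr0.
    exists 1 => // h _.
    rewrite (_ : _ - _ = 0) ?cabs0 ?mulr_ge0 ?(ltW e0) //.
    by rewrite /= /of_angle !(rmorphD, rmorphM) /=; ring.
  + have -> : partial (fun y => F (I0, y)) j (of_angle (fun j => th j + t * om j)) = 0.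
      apply: derive1_eq => b b0.
      have [d d0 hd] := NF (fun j => th j + t * om j) _ _ (unit_angle_le alpha j) _ b0.
      exists d => // h /hd; rewrite /= /pairing zsum0 => [|i]; last exact: mulr0.
      rewrite add0r scale0r addr0.
      rewrite /torus_point (_ : (I0, _) + h *: _ =
        (I0, of_angle (fun j => th j + t * om j) + h *: unit_seq R j)) //.
      by congr (_, _); rewrite /= scaler0 addr0.
    exists 1 => // h _.
    by rewrite oppr0 mulr0 subr0 /= subrr cabs0 mulr_ge0 ?(ltW e0).
Qed.

End FlatTorus.

Theorem corollary1p2 (R : realType) (alpha gamma : R)
    (halpha : 0 < alpha) (hgamma : 0 < gamma < 301^-1)
    (Cst : R) (hCst : 1 <= Cst)
    (s r : R) (hs : 0 < s) (hr : 0 < r)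
    (I0 : Seq R) (hI0 : (0 < norm1 alpha I0 < 1%:E)%E) :
  exists2 eps0 : R, 0 < eps0 &
    forall (beta eps : R)
      (h : int -> int -> Cx R -> Cx R -> Cx R)
      (f : int -> int -> Cx R -> Cx R -> Cx R -> Cx R -> Cx R)
      (omega : int -> R),
    let D := dom alpha I0 s r in
    let D' := dom alpha I0 (s / 2) (r / 2) in
    let H := Ham eps h f in
    0 < beta < 10^-1 ->
    0 < eps <= eps0 ->
    ham_defined alpha D h f ->
    (forall j, partial (H0 h) j I0 = (omega j)%:C) ->
    condA0 alpha D h ->
    condA1 alpha beta gamma r eps omega ->
    condA2 alpha beta eps (hessian h I0) ->
    condB0 alpha D f ->
    condB1 D f ->
    nonresonant alpha beta gamma r eps omega ->
    forall (Psi : Phase R -> Phase R) (e : Cx R)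
      (Omega : {linear Seq R -> Seq R}) (P : Phase R -> Cx R),
    Psi @` D' `<=` D ->
    equivariant_on D' Psi ->
    analytic_map alpha D' Psi ->
    real_map_on D' Psi ->
    symplectic_on alpha D' Psi ->
    analytic alpha (dom alpha 0 (s / 2) (r / 2)) P ->
    periodic_on (dom alpha 0 (s / 2) (r / 2)) P ->
    order_ge 3 (dom alpha 0 (s / 2) (r / 2)) P ->
    (forall I theta, D' (I, theta) ->
       H (Psi (I, theta)) =
         e + pairing (of_angle omega) (I - I0)
         + 2^-1 * pairing (Omega (I - I0)) (I - I0)
         + P (I - I0, theta)) ->
    (norm_on alpha D' (fun z => (Psi z - z)%R)
       <= (Cst * eps `^ (17 / 50))%:E)%E ->
    cabs (e - H0 h I0) <= Cst * (2 * eps) ->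
    (opnorm alpha (fun x => (Omega x - mxop (hessian h I0) x)%R)
       <= (Cst * eps `^ (1 / 5))%:E)%E ->
    kam_torus alpha D' (H \o Psi) omega (flat_torus I0) /\
    kam_torus alpha D H omega (Psi @` flat_torus I0).
Proof.
pose rho : R := Num.min (s / 2) (r / 2).
have s20 : 0 < s / 2 by rewrite divr_gt0.
have r20 : 0 < r / 2 by rewrite divr_gt0.
have rho0 : 0 < rho by rewrite lt_min s20.
have C0 : 0 < Cst by exact: lt_le_trans hCst.
have k0 : 0 < rho / 4 / Cst by rewrite !divr_gt0.
(* The exponent inverts 17/50, so that delta <= rho/4 and the Cauchy bound 2 delta/rho is at most
   1/2. *)
exists ((rho / 4 / Cst) `^ (50 / 17)); first exact: powR_gt0.
move=> beta eps h f omega D D' H _ /andP[eps_gt0 eps_le] hD omegaE _ _ _ _ _ _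
  Psi e Omega P PsiDD Psi_equiv [dPsi [PsiD PsiC]] _ Psi_sympl P_an _ P_order HE Psi_id _ _.
pose delta := Cst * eps `^ (17 / 50).
have deltaE : delta <= rho / 4.
  rewrite /delta mulrC -ler_pdivlMr //.
  apply: (@le_trans _ _ (((rho / 4 / Cst) `^ (50 / 17)) `^ (17 / 50))).
    by apply: ge0_ler_powR; rewrite ?nnegrE ?powR_ge0 // ltW.
  by rewrite -powRrM (_ : 50 / 17 * (17 / 50) = 1) ?powRr1 ?(ltW k0) //; field.
have Psi_id' z : D' z -> (normP alpha (Psi z - z)%R <= delta%:E)%E.
  by move=> zD; apply: le_trans Psi_id; apply: ereal_sup_ubound; exists z.
have dPsi_id th u (d : R) : 0 < d -> (normP alpha u <= d%:E)%E ->
    (normP alpha (dPsi (torus_point I0 th) u - u)%R <= (d / 2)%:E)%E.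
  move=> d0 ud.
  have rs : rho <= s / 2 by rewrite ge_min lexx.
  have rr : rho <= r / 2 by rewrite ge_min lexx orbT.
  apply: le_trans (near_identity_fderiv PsiD PsiC Psi_id' rho0 rs rr th d0 ud) _.
  rewrite lee_fin mulrC ler_wpM2l ?(ltW d0) // ler_pdivrMr //; lra.
have NF := @normal_form_dir R alpha I0 (s / 2) (r / 2) (H \o Psi) P e omega Omega s20 r20
  P_an P_order HE.
split; first exact: flat_kam_torus.
have [dH [dH_fderiv dH_cont]] := ham_analytic eps hD.
(* The frequency at [i] is the value of the bounded derivative of [H0] at a basis vector of norm at
   most [weight i]. *)
have [M M0 omega_le] : exists2 M : R, 0 < M & forall i, `|omega i| <= M * weight alpha i.
  have [_ [[dH0 [hdH0 _]] _]] := hD.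
  have ID := @dom_torus R alpha I0 s r (fun=> 0) hs hr.
  have [M M0 hM] := scalar_fderiv_bound (hdH0 _ ID).
  exists M => // i; rewrite -cabsR -omegaE.
  have -> : partial (H0 h) i I0 = dH0 (I0, of_angle (fun=> 0)) (unit_seq R i, 0).
    exact: (partial_action i (hdH0 _ ID)).
  by apply: hM; exact: unit_action_le.
apply: (embedding_kam_torus halpha s20 r20 PsiD Psi_id' dPsi_id Psi_equiv Psi_sympl hD _
  dH_fderiv dH_cont M0 omega_le NF).
by move=> z zD; apply: PsiDD; exists z.
Qed.
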